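(* Let $G$ be a countable group, let $\pi$ be a projective unitary representation of $G$ on a separable Hilbert space $\mathcal{H}$ with a multiplier $\mu$, and let $f\in\mathcal{H}$ be such that $\{\pi(g)f\}_{g\in G}$ is a frame for $\mathcal{H}$. Then: (i) There exists a vector $f_1\in\mathcal{H}$ such that $\{\pi(g)f_1\}_{g\in G}$ is a Parseval frame for $\mathcal{H}$ and, if $S$ is the frame operator of $\{\pi(g)f\}_{g\in G}$, then $$S^{1/2}(\pi(g)f_1)=\pi(g)f\qquad\text{for all }g\in G.$$ (ii) There exist a $\mu$-projective unitary representation $\pi'$ of $G$ on a Hilbert space $\mathcal{K}$ and a vector $f_2\in\mathcal{K}$ such that $\{\pi'(g)f_2\}_{g\in G}$ is a Parseval frame for $\mathcal{K}$ and $\{\pi(g)f_1\oplus\pi'(g)f_2\}_{g\in G}$ is an orthonormal basis for $\mathcal{H}\oplus\mathcal{K}$ (with $f_1$ the vector from (i)).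
   Context: A family $\{f_i\}_{i\in I}$ in a Hilbert space $\mathcal{H}$ is a frame for $\mathcal{H}$ if there exist $0<a\le b<\infty$ such that $a\|x\|^2\le\sum_{i\in I}|\langle x,f_i\rangle|^2\le b\|x\|^2$ for all $x\in\mathcal{H}$; it is a Parseval frame if this holds with $a=b=1$. The frame operator of a frame $\{f_i\}_{i\in I}$ is $Sx=\sum_{i\in I}\langle x,f_i\rangle f_i$, $x\in\mathcal{H}$. Let $\mathbb{T}=\{z\in\mathbb{C}:|z|=1\}$ and let $\mathcal{U}(\mathcal{H})$ be the group of unitary operators on $\mathcal{H}$. A projective unitary representation of $G$ on $\mathcal{H}$ is a mapping $\pi:G\to\mathcal{U}(\mathcal{H})$ such that $\pi(g)\pi(h)=\mu(g,h)\pi(gh)$ for all $g,h\in G$, where $\mu:G\times G\to\mathbb{T}$ is called the multiplier of $\pi$; one also says $\pi$ is a $\mu$-projective unitary representation. A multiplier satisfies $\mu(g_1,g_2g_3)\mu(g_2,g_3)=\mu(g_1g_2,g_3)\mu(g_1,g_2)$ for all $g_1,g_2,g_3\in G$, and $\mu(g,\mathbf{e})=\mu(\mathbf{e},g)=1$ for all $g\in G$, where $\mathbf{e}$ is the unit of $G$. *)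

(* Defs.v *)
From HB Require Import structures.
From mathcomp Require Import all_boot all_order all_algebra.
From mathcomp Require Import finmap.
From mathcomp Require Import all_classical all_reals all_analysis.
From mathcomp Require Import sesquilinear complex.
From mathcomp Require summability.
From mathcomp Require Import ring.

Set Implicit Arguments.
Unset Strict Implicit.
Unset Printing Implicit Defensive.

Import Order.TTheory GRing.Theory Num.Theory.
Import numFieldNormedType.Exports.

Local Open Scope classical_set_scope.
Local Open Scope ring_scope.
Local Open Scope complex_scope.

(* The inner product is linear in its first argument and conjugate-linear in
   its second one. *)
HB.mixin Record CompleteNormedModule_isHilbert (R : realType) H
    & CompleteNormedModule R[i] H := {
  hdot : {dot H for (@Num.conj R[i])};
  hdot_norm : forall x : H, hdot x x = `|x| ^+ 2
}.

#[short(type="hilbertType")]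
HB.structure Definition Hilbert (R : realType) :=
  {H of CompleteNormedModule R[i] H & CompleteNormedModule_isHilbert R H}.

Notation "''[' x , y ]" := (hdot x%R y%R)
  (format "''[' x ,  y ]") : ring_scope.

(* The library norms H * K by the maximum of the two norms; hsum H K is a copy
   of H * K that carries the Hilbert space structure of the direct sum. *)
Definition hsum (R : realType) (H K : hilbertType R) : Type := (H * K)%type.

Definition hpair (R : realType) (H K : hilbertType R) (x : H) (y : K) :
  hsum H K := (x, y).

Section HilbertSum.
Variables (R : realType) (H K : hilbertType R).
Implicit Types u v w : hsum H K.

HB.instance Definition _ := GRing.Lmodule.copy (hsum H K) (H * K)%type.

Definition hsum_dot u v : R[i] := '[u.1, v.1] + '[u.2, v.2].

Fact hsum_dot_bilinear :
  bilinear_for *%R (Num.conj \; *%R) hsum_dot.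
Proof.
split=> [v|v] a x y /=; rewrite /hsum_dot /=.
  by rewrite !linearDl !linearZl_LR mulrDr addrACA.
by rewrite !linearDr !linearZr_LR /= addrACA.
Qed.

HB.instance Definition _ := bilinear_isBilinear.Build R[i] (hsum H K) (hsum H K)
  R[i] *%R (Num.conj \; *%R) hsum_dot hsum_dot_bilinear.

Fact hsum_dot_hermitian u v : hsum_dot u v = (-1) ^+ false * (hsum_dot v u)^*.
Proof.
rewrite /hsum_dot rmorphD /= mul1r.
by rewrite (hermC hdot u.1) (hermC hdot u.2) /= !mul1r.
Qed.

HB.instance Definition _ := isHermitianSesquilinear.Build R[i] (hsum H K) false
  Num.conj hsum_dot hsum_dot_hermitian.

Fact hsum_dot_gt0 u : u != 0 -> 0 < hsum_dot u u.
Proof.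
move=> u0; rewrite /hsum_dot !hdot_norm lt_neqAle addr_ge0 ?exprn_ge0//.
rewrite andbT eq_sym paddr_eq0 ?exprn_ge0// !expf_eq0 /= !normr_eq0.
by apply: contra u0; case: u => x y /= /andP[/eqP-> /eqP->].
Qed.

HB.instance Definition _ :=
  isDotProduct.Build R[i] (hsum H K) hsum_dot hsum_dot_gt0.

Definition hsum_norm u : R[i] := sqrtC (`|u.1| ^+ 2 + `|u.2| ^+ 2).

Fact ler_hsum_normD u v : hsum_norm (u + v) <= hsum_norm u + hsum_norm v.
Proof.
rewrite /hsum_norm.
have := ler_normD u.2 v.2; have := ler_normD u.1 v.1; rewrite /=.
move: (normr_ge0 u.1) (normr_ge0 u.2) (normr_ge0 v.1) (normr_ge0 v.2).
move: (normr_ge0 (u.1 + v.1)) (normr_ge0 (u.2 + v.2)).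
move: `|u.1| `|u.2| `|v.1| `|v.2| `|u.1 + v.1| `|u.2 + v.2|.
move=> a b c d s t s0 t0 a0 b0 c0 d0 sac tbd.
have ab0 : 0 <= a ^+ 2 + b ^+ 2 by rewrite addr_ge0 ?exprn_ge0.
have cd0 : 0 <= c ^+ 2 + d ^+ 2 by rewrite addr_ge0 ?exprn_ge0.
have p0 : 0 <= sqrtC (a ^+ 2 + b ^+ 2) by rewrite sqrtC_ge0.
have q0 : 0 <= sqrtC (c ^+ 2 + d ^+ 2) by rewrite sqrtC_ge0.
have st0 : 0 <= s ^+ 2 + t ^+ 2 by rewrite addr_ge0 ?exprn_ge0.
have r0 : 0 <= a * c + b * d by rewrite addr_ge0 ?mulr_ge0.
rewrite -ler_sqr ?nnegrE ?sqrtC_ge0 ?(addr_ge0 p0 q0)// sqrrD !sqrtCK.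
have le_st : s ^+ 2 + t ^+ 2 <= (a + c) ^+ 2 + (b + d) ^+ 2.
  by rewrite lerD// ler_sqr ?nnegrE ?addr_ge0.
apply: (le_trans le_st).
have -> : (a + c) ^+ 2 + (b + d) ^+ 2 =
    a ^+ 2 + b ^+ 2 + (a * c + b * d) *+ 2 + (c ^+ 2 + d ^+ 2) by ring.
rewrite lerD2r lerD2l ler_pMn2r//.
rewrite -ler_sqr ?nnegrE ?mulr_ge0// exprMn !sqrtCK -subr_ge0.
have -> : (a ^+ 2 + b ^+ 2) * (c ^+ 2 + d ^+ 2) - (a * c + b * d) ^+ 2 =
    (a * d - b * c) ^+ 2 by ring.
by rewrite real_exprn_even_ge0// rpredB// rpredM// ger0_real.
Qed.

Fact hsum_normZ (l : R[i]) u : hsum_norm (l *: u) = `|l| * hsum_norm u.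
Proof.
rewrite /hsum_norm /= !normrZ !exprMn -mulrDr.
by rewrite sqrtCM ?nnegrE ?addr_ge0 ?exprn_ge0// sqrCK.
Qed.

Fact hsum_norm0_eq0 u : hsum_norm u = 0 -> u = 0.
Proof.
move=> /eqP; rewrite sqrtC_eq0 paddr_eq0 ?exprn_ge0// !expf_eq0 /= !normr_eq0.
by case: u => x y /= /andP[/eqP-> /eqP->].
Qed.

HB.instance Definition _ := Lmodule_isNormed.Build R[i] (hsum H K)
  ler_hsum_normD hsum_normZ hsum_norm0_eq0.

Fact hsum_norm_fst u : `|u.1| <= `|u|.
Proof.
by rewrite -ler_sqr ?nnegrE// sqrtCK lerDl exprn_ge0.
Qed.

Fact hsum_norm_snd u : `|u.2| <= `|u|.
Proof.
by rewrite -ler_sqr ?nnegrE// sqrtCK lerDr exprn_ge0.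
Qed.

Fact hsum_complete (F : set_system (hsum H K)) :
  ProperFilter F -> cauchy F -> cvg F.
Proof.
move=> FF /cauchyP Fc.
have /cauchy_cvg/cvg_ex[l1 cl1] : cauchy ((fun u : hsum H K => u.1) @ F).
  apply/cauchyP => e e0; have [x Fx] := Fc e e0; exists x.1.
  rewrite /fmap /nbhs/=; apply: filterS Fx => u; rewrite -!ball_normE/=.
  exact: le_lt_trans (hsum_norm_fst (x - u)).
have /cauchy_cvg/cvg_ex[l2 cl2] : cauchy ((fun u : hsum H K => u.2) @ F).
  apply/cauchyP => e e0; have [x Fx] := Fc e e0; exists x.2.
  rewrite /fmap /nbhs/=; apply: filterS Fx => u; rewrite -!ball_normE/=.
  exact: le_lt_trans (hsum_norm_snd (x - u)).
apply/cvg_ex; exists (hpair l1 l2); apply/cvgrPdist_lt => e e0.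
have e20 : 0 < e / 2 by rewrite divr_gt0.
move/cvgrPdist_lt/(_ _ e20) : cl1 => n1; move/cvgrPdist_lt/(_ _ e20) : cl2 => n2.
apply: filterS2 n1 n2 => u /= h1 h2.
rewrite [e]splitr; apply: le_lt_trans (ltrD h1 h2).
rewrite -ler_sqr ?nnegrE ?addr_ge0// sqrtCK sqrrD.
by rewrite addrAC lerDl mulrn_wge0// mulr_ge0.
Qed.

HB.instance Definition _ :=
  Uniform_isComplete.Build (hsum H K) hsum_complete.

Fact hsum_dot_norm u : hsum_dot u u = `|u| ^+ 2.
Proof. by rewrite sqrtCK /hsum_dot !hdot_norm. Qed.

HB.instance Definition _ :=
  CompleteNormedModule_isHilbert.Build R (hsum H K) hsum_dot_norm.

End HilbertSum.

Definition separable (T : topologicalType) :=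
  exists2 D : set T, countable D & dense D.

Section Frames.
Variables (R : realType) (H : hilbertType R) (I : choiceType).
Implicit Types (F : I -> H) (x : H).

(* Squared moduli and norms are elements of R[i]; Re brings them back to R. *)
Definition frame_sum F x : \bar R :=
  (\esum_(i in [set: I]) (complex.Re (`|'[x, F i]| ^+ 2))%:E)%E.

Definition frame_bounds (a b : R) F := forall x,
  ((a * complex.Re (`|x| ^+ 2))%:E <= frame_sum F x)%E /\
  (frame_sum F x <= (b * complex.Re (`|x| ^+ 2))%:E)%E.

Definition is_frame F :=
  exists a b : R, [/\ 0 < a, a <= b & frame_bounds a b F].

Definition parseval_frame F := frame_bounds 1 1 F.

(* The sum is the limit in norm of the net of finite partial sums. *)
Definition frame_operator F x : H :=
  summability.sum (fun i => '[x, F i] *: F i).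

Definition orthonormal_family F := forall i j, '[F i, F j] = (i == j)%:R.

Definition family_span F : set H :=
  [set x | exists (A : {fset I}) (c : I -> R[i]),
     x = \sum_(i <- enum_fset A) c i *: F i].

Definition orthonormal_basis F :=
  orthonormal_family F /\ closure (family_span F) = [set: H].

End Frames.

Section Operators.
Variables (R : realType) (H : hilbertType R).

Definition unitary (U : {linear H -> H}) :=
  bijective U /\ forall x y, '[U x, U y] = '[x, y].

(* T = S^{1/2}.  In the order of R[i], 0 <= z says that z is a nonnegative real
   number, so that the second clause is positivity (hence self-adjointness). *)
Definition is_positive_sqrt (S : H -> H) (T : {linear H -> H}) :=
  [/\ continuous T, forall x, 0 <= '[T x, x] & forall x, T (T x) = S x].

End Operators.

Section ProjectiveRepresentations.
Variables (R : realType) (G : groupType).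

Definition multiplier (mu : G -> G -> R[i]) :=
  [/\ forall g h, `|mu g h| = 1,
      forall g1 g2 g3,
        mu g1 (g2 * g3)%g * mu g2 g3 = mu (g1 * g2)%g g3 * mu g1 g2
    & forall g, mu g 1%g = 1 /\ mu 1%g g = 1].

Definition projective_representation (H : hilbertType R)
    (mu : G -> G -> R[i]) (pi : G -> {linear H -> H}) :=
  [/\ multiplier mu, forall g, unitary (pi g)
    & forall g h x, pi g (pi h x) = mu g h *: pi (g * h)%g x].

End ProjectiveRepresentations.

(* Main.v *)
Require Import Defs.
From HB Require Import structures.
From mathcomp Require Import all_boot all_order all_algebra.
From mathcomp Require Import finmap.
From mathcomp Require Import all_classical all_reals all_analysis.
From mathcomp Require Import sesquilinear complex.
From mathcomp Require summability.
From mathcomp Require Import ring.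

Set Implicit Arguments.
Unset Strict Implicit.
Unset Printing Implicit Defensive.

Import Order.TTheory GRing.Theory Num.Theory.
Import numFieldNormedType.Exports.

Local Open Scope complex_scope.
Local Open Scope classical_set_scope.
Local Open Scope ring_scope.

(** The frame operator [S] of an orbit [pi g f] satisfies
      ['[S x, y] = \sum_g '[x, pi g f] '[pi g f, y]],
    and replacing [x] and [y] by [pi h x] and [pi h y] only permutes the terms,
    the values of the multiplier cancelling; so [S] commutes with every [pi h].
    The frame inequalities make [S] positive and invertible.  Its positive
    square root [T] is a limit of polynomials in [S], so it commutes with the
    representation too, and [f1 := T^-1 f] is mapped by [T] to [f], hence
    [pi g f1] to [pi g f].  Writing [x = T y] gives
      [\sum_g |'[x, pi g f1]|^2 = \sum_g |'[y, pi g f]|^2 = '[S y, y] = |x|^2],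
    which is the Parseval property ([frame_operator_sqrt],
    [frame_operator_commute]).

    For the square root, if the frame bounds are [a] and [b] then
    [B := 1 - S / b] has norm at most [q := sqrt (1 - a / b) < 1]: this follows
    from [|S x|^2 <= b '[S x, x]].  On the operators of norm at most [q] the map
    [X |-> (B + X^2) / 2] is a contraction with constant [q]; its fixed point
    satisfies [(1 - X)^2 = 1 - B], so [T := sqrt b (1 - X)] is the root, and
    [1 - X] is onto because [X] is a strict contraction
    ([positive_sqrt_exists]).

    For the dilation, let [theta x g := '[x, pi g f1]].  By the Parseval property
    [theta] embeds [H] isometrically in the square-summable functions on [G], and
    it intertwines [pi] with the left regular representation twisted by [mu]
    ([frame_coef_rep]).  Let [K] be the orthogonal complement of the range of
    [theta], with the restricted action, and let [f2] be the component in [K] of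
    the indicator of the unit of [G].  The [g]-th translate of that indicator is
    the indicator of [g], so [theta (pi g f1)] and [pi' g f2] are its two
    components; the pairs [(pi g f1, pi' g f2)] are thus the image of the
    canonical basis under the isomorphism of the square-summable functions with
    the direct sum of [H] and [K].  The proof uses this through the identity
    ['[k, pi' g f2] = k g] for [k] in [K] ([dot_dilation_orbit]). *)

(** * Unconditional sums of families *)

#[local] Existing Instance summability.totally_filter.

Section Sums.
Variables (R : realType) (I : choiceType).
Local Notation C := R[i].
Implicit Types (A B : {fset I}).

(** Convergence of the net of finite partial sums, spelled out so that it applies
    to scalars and to vectors alike; [has_sum_summability] is the link with the
    limit along the filter of finite sets. *)
Definition has_sum (V : normedZmodType C) (u : I -> V) (s : V) :=
  forall e : C, 0 < e -> exists A : {fset I}, forall B : {fset I},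
    (A `<=` B)%fset -> `|s - \sum_(i <- B) u i| < e.

Lemma small_eq0 (V : normedZmodType C) (x : V) :
  (forall e : C, 0 < e -> `|x| < e) -> x = 0.
Proof.
move=> xe; apply/eqP; rewrite -normr_eq0; apply/contraT => x0.
have : 0 < `|x| by rewrite lt_neqAle eq_sym x0 normr_ge0.
by move=> /xe; rewrite ltxx.
Qed.

Section Normed.
Variable V : normedZmodType C.
Implicit Types (u v : I -> V).

Lemma has_sum_unique u s t : has_sum u s -> has_sum u t -> s = t.
Proof.
move=> us ut; apply/eqP; rewrite -subr_eq0; apply/eqP/small_eq0 => e e0.
have e20 : 0 < e / 2 by rewrite divr_gt0.
have [A HA] := us _ e20; have [B HB] := ut _ e20.
have := HA (A `|` B)%fset (fsubsetUl _ _).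
have := HB (A `|` B)%fset (fsubsetUr _ _).
set p := \sum_(i <- _) _ => h1 h2; rewrite [e]splitr.
apply: le_lt_trans (ltrD h2 h1).
by rewrite (distrC t) (le_trans _ (ler_normD _ _))// addrA subrK.
Qed.

Lemma eq_has_sum u v s : u =1 v -> has_sum u s -> has_sum v s.
Proof. by move=> /funext ->. Qed.

Lemma has_sumD u v s t : has_sum u s -> has_sum v t ->
  has_sum (fun i => u i + v i) (s + t).
Proof.
move=> us vt e e0; have e20 : 0 < e / 2 by rewrite divr_gt0.
have [A HA] := us _ e20; have [B HB] := vt _ e20.
exists (A `|` B)%fset => D; rewrite fsubUset => /andP[/HA h1 /HB h2].
rewrite big_split/= opprD addrACA [e]splitr.
exact: le_lt_trans (ler_normD _ _) (ltrD h1 h2).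
Qed.

Lemma has_sum_single u (i0 : I) : (forall i, i != i0 -> u i = 0) ->
  has_sum u (u i0).
Proof.
move=> ui e e0; exists [fset i0]%fset => B /fsubsetP/(_ i0).
rewrite inE eqxx => /(_ isT) i0B; rewrite (big_fsetD1 i0)//=.
rewrite big_seq big1 ?addr0 ?subrr ?normr0// => i.
by rewrite !inE => /andP[/ui].
Qed.

Lemma has_sum_reindex u s (h h' : I -> I) : cancel h h' -> cancel h' h ->
  has_sum u s -> has_sum (fun i => u (h i)) s.
Proof.
move=> hK h'K us e /us[A HA]; exists [fset h' x | x in A]%fset => B AB.
have hi : {in B &, injective h} by move=> x y _ _; exact: can_inj hK x y.
rewrite -(big_imfset _ imfset_key u hi); apply: HA; apply/fsubsetP => x xA.
apply/imfsetP; exists (h' x); rewrite ?h'K//=.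
by apply: (fsubsetP AB); apply/imfsetP; exists x.
Qed.

End Normed.

Lemma has_sum_map (V W : normedZmodType C) (f : V -> W) (c : C) u s :
  0 <= c -> {morph f : x y / x + y} -> (forall x, `|f x| <= c * `|x|) ->
  has_sum u s -> has_sum (fun i => f (u i)) (f s).
Proof.
move=> c0 fD fc us.
have f0 : f 0 = 0 by apply: (@addrI _ (f 0)); rewrite -fD !addr0.
have fN x : f (- x) = - f x.
  by apply: (@addrI _ (f x)); rewrite -fD !subrr.
have fS A : f (\sum_(i <- A) u i) = \sum_(i <- A) f (u i).
  by rewrite (big_morph f fD f0).
have c1 : 0 < c + 1 by rewrite ltr_wpDl.
move=> e e0; have [A HA] := us (e / (c + 1)) (divr_gt0 e0 c1).
exists A => B /HA; rewrite -fS -fN -fD ltr_pdivlMr// => h; apply: le_lt_trans h.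
by apply: le_trans (fc _) _; rewrite mulrC ler_wpM2l// lerDl ler01.
Qed.

Lemma has_sumZ (u : I -> C) a s :
  has_sum u s -> has_sum (fun i => a * u i) (a * s).
Proof.
by apply: (has_sum_map (normr_ge0 a)) => [b c|b]; rewrite ?mulrDr ?normrM.
Qed.

Lemma has_sum_conj (u : I -> C) s :
  has_sum u s -> has_sum (fun i => (u i)^*) s^*.
Proof.
by apply: (has_sum_map ler01) => [b c|b]; rewrite ?rmorphD ?norm_conjC ?mul1r.
Qed.

(** The nonnegative reals are closed in the complex numbers: [`|d| - d] is small as
    soon as [d] is near some [t >= 0], for which [`|t| - t = 0].  All passages of
    inequalities to the limit below come down to this. *)
Lemma near_ge0 (d : C) :
  (forall e : C, 0 < e -> exists2 t : C, 0 <= t & `|d - t| < e) -> 0 <= d.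
Proof.
move=> dt; suff /eqP : `|d| - d = 0 by rewrite subr_eq0 => /eqP <-.
apply: small_eq0 => e e0; have e20 : 0 < e / 2 by rewrite divr_gt0.
have [t t0 dte] := dt _ e20.
have -> : `|d| - d = (`|d| - `|t|) - (d - t).
  by rewrite (ger0_norm t0) opprB addrA subrK.
rewrite [e]splitr; apply: le_lt_trans (ler_normB _ _) _; rewrite ltrD//.
exact: le_lt_trans (ler_dist_dist _ _) dte.
Qed.

Lemma sum_fsetD (V : zmodType) (u : I -> V) A B : (A `<=` B)%fset ->
  \sum_(i <- B) u i = \sum_(i <- A) u i + \sum_(i <- (B `\` A)%fset) u i.
Proof.
move=> AB; rewrite (big_fsetID _ (mem A))/=; congr (_ + _).
  congr bigop.body; congr enum_fset; apply/fsetP => x.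
  by rewrite !inE/= andbC; apply/andb_idr/(fsubsetP AB).
congr bigop.body; congr enum_fset; apply/fsetP => x.
by rewrite !inE/= andbC.
Qed.

Section Nonneg.
Variable w : I -> C.
Hypothesis w0 : forall i, 0 <= w i.

Lemma psum_ge0 A : 0 <= \sum_(i <- A) w i.
Proof. by apply: sumr_ge0. Qed.

Lemma ler_psum A B : (A `<=` B)%fset -> \sum_(i <- A) w i <= \sum_(i <- B) w i.
Proof. by move=> AB; rewrite (sum_fsetD _ AB) lerDl psum_ge0. Qed.

Lemma psum_le s A : has_sum w s -> \sum_(i <- A) w i <= s.
Proof.
move=> ws; rewrite -subr_ge0; apply: near_ge0 => e /ws[B HB].
exists (\sum_(i <- (A `|` B)%fset) w i - \sum_(i <- A) w i).
  by rewrite subr_ge0 ler_psum// fsubsetUl.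
by rewrite opprB addrA subrK HB// fsubsetUr.
Qed.

(** The sum is the supremum of the partial sums, which are real because they are
    nonnegative. *)
Lemma nonneg_has_sum (c : C) : (forall A, \sum_(i <- A) w i <= c) ->
  exists s, has_sum w s.
Proof.
move=> wc; pose E := range (fun A => complex.Re (\sum_(i <- A) w i)).
have hE A : (complex.Re (\sum_(i <- A) w i))%:C = \sum_(i <- A) w i.
  by rewrite RRe_real// ger0_real// psum_ge0.
have cR : (complex.Re c)%:C = c.
  by rewrite RRe_real// ger0_real//; have := wc fset0; rewrite big_seq_fset0.
have supE : has_sup E.
  split; first by exists (complex.Re (\sum_(i <- fset0) w i)); exists fset0.
  by exists (complex.Re c) => _ [A _ <-]; rewrite -lecR hE cR.
exists (sup E)%:C => e e0.
have eR : (complex.Re e)%:C = e by rewrite RRe_real// gtr0_real.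
have eR0 : 0 < complex.Re e by rewrite -ltcR eR.
have [_ [A _ <-]] := sup_adherent eR0 supE.
move=> hA; exists A => B AB.
have BE : \sum_(i <- B) w i <= (sup E)%:C.
  by rewrite -hE lecR sup_upper_bound//; exists B.
rewrite ger0_norm ?subr_ge0// ltrBlDr -ltrBlDl.
apply: lt_le_trans (ler_psum AB).
by rewrite -hE -eR -raddfB/= ltcR.
Qed.

End Nonneg.

Lemma has_sum_ler (u : I -> C) s c :
  has_sum u s -> (forall A, \sum_(i <- A) u i <= c) -> s <= c.
Proof.
move=> us uc; rewrite -subr_ge0; apply: near_ge0 => e /us[A HA].
exists (c - \sum_(i <- A) u i); first by rewrite subr_ge0.
by rewrite opprB addrC addrA subrK distrC HA.
Qed.

Lemma has_sum_norm_ler (V : normedZmodType C) (u : I -> V) s c :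
  has_sum u s -> (forall A, `|\sum_(i <- A) u i| <= c) -> `|s| <= c.
Proof.
move=> us uc; have c0 : 0 <= c by apply: le_trans (uc fset0).
rewrite -subr_ge0; apply: near_ge0 => e /us[A HA].
exists (c - `|\sum_(i <- A) u i|); first by rewrite subr_ge0.
rewrite opprB addrC addrA subrK distrC.
exact: le_lt_trans (ler_dist_dist _ _) (HA _ (fsubset_refl _)).
Qed.

Lemma has_sum_summability (V : normedModType C) (u : I -> V) s :
  has_sum u s -> summability.sum u = s.
Proof.
move=> us; apply: norm_cvg_lim; apply/cvgrPdist_lt => e /us[A HA].
exists A => // B /= /HA; rewrite /summability.partial_sum.
by rewrite big_seq_fsetE.
Qed.

(** Cauchy criterion: the tails of the convergent family [w] are small, and they
    control those of [u].  Completeness is a hypothesis on [V] so that the lemma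
    covers the complex line as well as Hilbert spaces. *)
Lemma dominated_has_sum (V : normedModType C) (u : I -> V) (w : I -> C)
    (c : C) :
  (forall F : set_system V, ProperFilter F -> cauchy F -> cvg F) ->
  (forall i, 0 <= w i) -> has_sum w c ->
  (forall e, 0 < e -> exists2 d, 0 < d &
    forall A, \sum_(i <- A) w i < d -> `|\sum_(i <- A) u i| < e) ->
  exists s, has_sum u s.
Proof.
move=> V_complete w0 wc uw.
have /V_complete/cvg_ex[s us] :
    cauchy ((fun A => \sum_(i <- A) u i) @ @summability.totally I).
  apply/cauchyP => e /uw[d d0 Hd]; have [A HA] := wc _ d0.
  exists (\sum_(i <- A) u i); exists A => // B /= AB.
  rewrite -ball_normE/= (sum_fsetD _ AB) opprD addrA subrr sub0r normrN Hd//.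
  have -> : \sum_(i <- (B `\` A)%fset) w i =
      \sum_(i <- B) w i - \sum_(i <- A) w i.
    by rewrite (sum_fsetD _ AB) addrC addrA addNr add0r.
  have := HA _ (fsubset_refl _).
  rewrite ger0_norm ?subr_ge0 ?psum_le//; apply: le_lt_trans.
  by rewrite lerD2r psum_le.
exists s => e e0; move/cvgrPdist_lt/(_ _ e0) : us => [A _ HA].
by exists A => B /HA.
Qed.

Lemma esum_ge_psum (w : I -> R) (A : {fset I}) : (forall i, 0 <= w i) ->
  ((\sum_(i <- A) w i)%:E <= \esum_(i in [set: I]) (w i)%:E)%E.
Proof.
move=> w0; apply: esum_ge; exists [set` A]; first by split.
by rewrite fsbig_finite//= set_fsetK sumEFin.
Qed.

Lemma sum_real_complex (w : I -> R) (A : {fset I}) :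
  \sum_(i <- A) (w i)%:C = (\sum_(i <- A) w i)%:C :> C.
Proof. by rewrite rmorph_sum. Qed.

(** Links the sums of this file with the extended-real sums that define frame
    bounds. *)
Lemma has_sum_esum (w : I -> R) (r : R) : (forall i, 0 <= w i) ->
  has_sum (fun i => (w i)%:C) r%:C -> (\esum_(i in [set: I]) (w i)%:E = r%:E)%E.
Proof.
move=> w0 wr; apply/eqP; rewrite eq_le; apply/andP; split.
  apply: ub_ereal_sup => _ [A [fA _] <-].
  rewrite fsbig_finite//= sumEFin lee_fin -lecR -sum_real_complex.
  by apply: psum_le wr => i; rewrite ler0c.
apply/lee_addgt0Pr => e e0.
have eC : 0 < e%:C :> C by rewrite ltcR.
have [A HA] := wr _ eC; have := HA _ (fsubset_refl _).
rewrite sum_real_complex -raddfB/= => h.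
apply: le_trans (leeD2r _ (esum_ge_psum A w0)).
rewrite -EFinD lee_fin -lerBlDl -lecR ltW//; apply: le_lt_trans h.
by apply: real_ler_norm; apply/complex_realP; eexists.
Qed.

End Sums.

(** * Completeness of the complex numbers *)

Section ComplexComplete.
Variable R : realType.
Local Notation C := R[i].

(** Real and imaginary parts are contractions, so they send Cauchy filters to
    Cauchy filters; the limit is assembled from the two real ones. *)
Lemma complex_cauchy_cvg (F : set_system C^o) :
  ProperFilter F -> cauchy F -> cvg F.
Proof.
move=> FF /cauchyP Fc.
have norm_le (x : C) : `|x| <= `|complex.Re x|%:C + `|complex.Im x|%:C.
  rewrite {1}(complexE x); apply: le_trans (ler_normD _ _) _.
  by rewrite normrM !normc_def /= !expr0n !expr1n /= addr0 add0r sqrtr1 mul1r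
    !addr0 !sqrtr_sqr.
have le_Re (x : C) : `|complex.Re x|%:C <= `|x| by exact: normc_ge_Re.
have le_Im (x : C) : `|complex.Im x|%:C <= `|x|.
  have := normc_ge_Re (x * 'i%C); rewrite ReiNIm normrN normrM.
  by rewrite (_ : `|'i%C| = 1) ?mulr1// normc_def /= expr0n expr1n add0r sqrtr1.
have part (g : {additive C -> R}) : (forall x, `|g x|%:C <= `|x|) ->
    exists l : R, forall e : R, 0 < e -> F [set x | `|l - g x| < e].
  move=> gle; have /cauchy_cvg/cvg_ex[l cl] : cauchy (g @ F).
    apply/cauchyP => e e0; have eC : 0 < e%:C :> C by rewrite ltcR.
    have [x Fx] := Fc _ eC; exists (g x); rewrite /fmap /nbhs/=.
    apply: filterS Fx => u; rewrite -!ball_normE/= => h; rewrite -raddfB -ltcR.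
    exact: le_lt_trans (gle _) h.
  by exists l => e e0; move/cvgrPdist_lt/(_ _ e0) : cl.
have ReD : additive (@complex.Re R) by move=> [? ?] [? ?].
have ImD : additive (@complex.Im R) by move=> [? ?] [? ?].
pose ReA : {additive C -> R} :=
  HB.pack (@complex.Re R) (GRing.isAdditive.Build _ _ _ ReD).
pose ImA : {additive C -> R} :=
  HB.pack (@complex.Im R) (GRing.isAdditive.Build _ _ _ ImD).
have [a Ha] := part ReA le_Re; have [b Hb] := part ImA le_Im.
apply/cvg_ex; exists (a +i* b)%C; apply/cvgrPdist_lt => e e0.
have eR : (complex.Re e)%:C = e by rewrite RRe_real// gtr0_real.
have e20 : 0 < complex.Re e / 2 by rewrite divr_gt0// -ltcR eR.
apply: filterS2 (Ha _ e20) (Hb _ e20) => x /= h1 h2.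
apply: le_lt_trans (norm_le _) _.
rewrite -eR [complex.Re e]splitr -rmorphD/= ltcR ltrD//.
  by move: h1; case: (x).
by move: h2; case: (x).
Qed.

End ComplexComplete.

(** * The Cauchy-Schwarz inequality *)

Section CauchySchwarz.
Variables (C : numClosedFieldType) (U : lmodType C).
Variable form : {dot U for @Num.conj C}.

(** Split [u] into its projection [a *: v] on [v] and a rest [w] orthogonal to
    [v]; the defect in the inequality is ['[w, w] * '[v, v]]. *)
Lemma dot_CauchySchwarz (u v : U) :
  `|form u v| ^+ 2 <= form u u * form v v.
Proof.
have [->|v0] := eqVneq v 0; first by rewrite !linear0r/= normr0 expr0n/= ?mulr0.
have vv : 0 < form v v by rewrite dnorm_gt0.
pose a := form u v / form v v; pose w := u - a *: v.
have wv : form w v = 0.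
  by rewrite linearBl linearZl_LR /= /a divfK ?gt_eqF ?subrr.
have uv : form u v = a * form v v by rewrite divfK ?gt_eqF.
have uu : form u u = form w w + `|a| ^+ 2 * form v v.
  rewrite -dnormZ -hnormDd ?subrK//.
  by rewrite linearZr_LR/= wv mulr0.
rewrite uv uu mulrDl normrM exprMn (ger0_norm (ltW vv)).
by rewrite (expr2 (form v v)) mulrA lerDr mulr_ge0 ?dnorm_ge0.
Qed.

Lemma dot_triangle (u v : U) :
  sqrtC (form (u + v) (u + v)) <= sqrtC (form u u) + sqrtC (form v v).
Proof.
rewrite -ler_sqr ?nnegrE ?addr_ge0 ?sqrtC_ge0 ?dnorm_ge0//.
rewrite sqrrD !sqrtCK dnormD/= [leRHS]addrAC lerD2l.
have d_le : `|form u v| <= sqrtC (form u u) * sqrtC (form v v).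
  rewrite -ler_sqr ?nnegrE ?mulr_ge0 ?sqrtC_ge0 ?dnorm_ge0//.
  by rewrite exprMn !sqrtCK dot_CauchySchwarz.
apply: le_trans (_ : `|form u v| *+ 2 <= _); last by rewrite ler_pMn2r.
apply: le_trans (real_ler_norm _) _; first last.
  by apply: le_trans (ler_normD _ _) _; rewrite norm_conjC mulr2n.
by rewrite CrealE rmorphD/= conjCK addrC.
Qed.

End CauchySchwarz.

(** * Square-summable families *)

Section SquareSummable.
Variables (R : realType) (I : choiceType).
Local Notation C := R[i].
Implicit Types (x y z w : I -> C).

Definition sqsum x :=
  exists c : C, forall A : {fset I}, \sum_(i <- A) `|x i| ^+ 2 <= c.

Lemma ler_sqnormD (a b : C) : `|a + b| ^+ 2 <= (`|a| ^+ 2 + `|b| ^+ 2) *+ 2.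
Proof.
apply: le_trans (_ : (`|a| + `|b|) ^+ 2 <= _).
  by rewrite ler_sqr ?nnegrE ?addr_ge0// ler_normD.
rewrite -subr_ge0; have -> : (`|a| ^+ 2 + `|b| ^+ 2) *+ 2 - (`|a| + `|b|) ^+ 2 =
  (`|a| - `|b|) ^+ 2 by ring.
by rewrite real_exprn_even_ge0// rpredB// normr_real.
Qed.

Lemma ler_normM_sqr (a b : C) : `|a * b^*| <= `|a| ^+ 2 + `|b| ^+ 2.
Proof.
rewrite normrM norm_conjC -subr_ge0.
have p0 : 0 <= `|a| * `|b| by rewrite mulr_ge0.
have -> : `|a| ^+ 2 + `|b| ^+ 2 - `|a| * `|b| =
  (`|a| - `|b|) ^+ 2 + `|a| * `|b| by ring.
by rewrite addr_ge0// real_exprn_even_ge0// rpredB// normr_real.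
Qed.

Lemma sqsumD x y : sqsum x -> sqsum y -> sqsum (fun i => x i + y i).
Proof.
move=> [c Hc] [d Hd]; exists ((c + d) *+ 2) => A.
apply: le_trans (_ : \sum_(i <- A) ((`|x i| ^+ 2 + `|y i| ^+ 2) *+ 2) <= _).
  by apply: ler_sum => i _; exact: ler_sqnormD.
by rewrite sumrMnl big_split/= ler_pMn2r// lerD.
Qed.

Lemma sqsumZ a x : sqsum x -> sqsum (fun i => a * x i).
Proof.
move=> [c Hc]; exists (`|a| ^+ 2 * c) => A.
under eq_bigr do rewrite normrM exprMn.
by rewrite -mulr_sumr ler_wpM2l// exprn_ge0.
Qed.

Lemma sqsum0 : sqsum (fun=> 0).
Proof. by exists 0 => A; rewrite big1// => i _; rewrite normr0 expr0n. Qed.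

Lemma sqsum_has_sum x : sqsum x -> exists s, has_sum (fun i => `|x i| ^+ 2) s.
Proof.
by case=> c; apply: nonneg_has_sum => i; rewrite exprn_ge0.
Qed.

Lemma l2dot_has_sum x y : sqsum x -> sqsum y ->
  exists s : C, has_sum (fun i => x i * (y i)^*) s.
Proof.
move=> /sqsum_has_sum[s xs] /sqsum_has_sum[t yt].
apply: (@dominated_has_sum R I C^o _ _ _ (@complex_cauchy_cvg R) _
  (has_sumD xs yt)).
  by move=> i; rewrite addr_ge0 ?exprn_ge0.
move=> e e0; exists e => // A; apply: le_lt_trans.
apply: le_trans (ler_norm_sum _ _ _) (ler_sum _ _) => i _.
exact: ler_normM_sqr.
Qed.

(** The inner product of square-summable families; the value 0 is a default for
    pairs whose products cannot be summed. *)
Definition l2dot x y : C := xget 0 [set s | has_sum (fun i => x i * (y i)^*) s].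

Lemma l2dotP x y : sqsum x -> sqsum y ->
  has_sum (fun i => x i * (y i)^*) (l2dot x y).
Proof. by move=> x2 y2; apply: xgetPex; exact: l2dot_has_sum. Qed.

Lemma l2dotE x y s : has_sum (fun i => x i * (y i)^*) s -> l2dot x y = s.
Proof.
move=> xys; apply: has_sum_unique (xys).
by apply: (@xgetPex _ 0 [set s | has_sum _ s]); exists s.
Qed.

Lemma l2dot_normE x s : has_sum (fun i => `|x i| ^+ 2) s -> l2dot x x = s.
Proof.
by move=> xs; apply: l2dotE; apply: eq_has_sum xs => i; rewrite normCK.
Qed.

Lemma l2dot_normP x : sqsum x -> has_sum (fun i => `|x i| ^+ 2) (l2dot x x).
Proof. by move=> x2; apply: eq_has_sum (l2dotP x2 x2) => i; rewrite normCK. Qed.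

Lemma l2dotDl x y z : sqsum x -> sqsum y -> sqsum z ->
  l2dot (fun i => x i + y i) z = l2dot x z + l2dot y z.
Proof.
move=> x2 y2 z2; apply: l2dotE.
apply: eq_has_sum (has_sumD (l2dotP x2 z2) (l2dotP y2 z2)) => i.
by rewrite mulrDl.
Qed.

Lemma l2dotZl a x y : sqsum x -> sqsum y ->
  l2dot (fun i => a * x i) y = a * l2dot x y.
Proof.
move=> x2 y2; apply: l2dotE.
by apply: eq_has_sum (has_sumZ a (l2dotP x2 y2)) => i; rewrite mulrA.
Qed.

Lemma l2dotC x y : sqsum x -> sqsum y -> l2dot y x = (l2dot x y)^*.
Proof.
move=> x2 y2; apply: l2dotE.
apply: eq_has_sum (has_sum_conj (l2dotP x2 y2)) => i.
by rewrite rmorphM/= conjCK mulrC.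
Qed.

Lemma l2dotDr x y z : sqsum x -> sqsum y -> sqsum z ->
  l2dot z (fun i => x i + y i) = l2dot z x + l2dot z y.
Proof.
move=> x2 y2 z2; rewrite l2dotC//; last exact: sqsumD.
by rewrite l2dotDl// rmorphD/= -!l2dotC.
Qed.

Lemma l2dotZr a x y : sqsum x -> sqsum y ->
  l2dot y (fun i => a * x i) = a^* * l2dot y x.
Proof.
move=> x2 y2; rewrite l2dotC//; last exact: sqsumZ.
by rewrite l2dotZl// rmorphM/= -l2dotC.
Qed.

Lemma l2dot_ge x i : sqsum x -> `|x i| ^+ 2 <= l2dot x x.
Proof.
move=> /l2dot_normP xx.
have := psum_le (fun i => exprn_ge0 2 (normr_ge0 (x i))) [fset i]%fset xx.
by rewrite big_seq_fset1.
Qed.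

Lemma l2dot_ge0 x : sqsum x -> 0 <= l2dot x x.
Proof.
move=> /l2dot_normP xx.
have := psum_le (fun i => exprn_ge0 2 (normr_ge0 (x i))) fset0%fset xx.
by rewrite big_seq_fset0.
Qed.

Lemma l2dot_ler x c : (forall A : {fset I}, \sum_(i <- A) `|x i| ^+ 2 <= c) ->
  l2dot x x <= c.
Proof.
move=> xc; have x2 : sqsum x by exists c.
exact: has_sum_ler (l2dot_normP x2) xc.
Qed.

End SquareSummable.

(** * Orthogonal complements in the square-summable families *)

Section OrthogonalComplement.
Variables (R : realType) (I : choiceType) (W : set (I -> R[i])).
Local Notation C := R[i].

(** The complement of an arbitrary set [W] of families; only its square-summable
    members impose a condition, which makes this a closed subspace whatever [W]
    is.  For [W = set0] it is the whole space of square-summable families. *)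
Definition l2perp_pred : {pred I -> C^o} := fun x =>
  `[< sqsum x /\ forall w, W w -> sqsum w -> l2dot x w = 0 >].

Fact l2perp_submod_closed : submod_closed l2perp_pred.
Proof.
split.
  apply/asboolP; split; first exact: sqsum0.
  move=> w _ w2; apply: l2dotE.
  have := has_sumZ 0 (l2dotP w2 w2); rewrite mul0r; apply: eq_has_sum => i.
  by rewrite !mul0r.
move=> a x y /asboolP[x2 xW] /asboolP[y2 yW].
have ax2 : sqsum (fun i => a * x i) by exact: sqsumZ.
apply/asboolP; split; first exact: sqsumD ax2 y2.
move=> w Ww w2; have := l2dotDl ax2 y2 w2.
by rewrite l2dotZl// xW// yW// mulr0 addr0.
Qed.

HB.instance Definition _ :=
  GRing.isSubmodClosed.Build C (I -> C^o) l2perp_pred l2perp_submod_closed.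

Record l2perp := L2Perp { l2val :> I -> C^o; l2valP : l2val \in l2perp_pred }.

HB.instance Definition _ := [isSub for l2val].
HB.instance Definition _ := [Choice of l2perp by <:].
HB.instance Definition _ := [SubChoice_isSubLmodule of l2perp by <:].

Implicit Types x y z : l2perp.

Lemma l2val_sqsum x : sqsum x.
Proof. by have /asboolP[] := l2valP x. Qed.
Hint Resolve l2val_sqsum : core.

Definition l2perp_dot x y : C := l2dot x y.

Fact l2perp_dot_bilinear : bilinear_for *%R (@Num.conj C \; *%R) l2perp_dot.
Proof.
split=> [z|z] a x y /=; rewrite /l2perp_dot.
  have := l2dotDl (sqsumZ a (l2val_sqsum x)) (l2val_sqsum y) (l2val_sqsum z).
  by rewrite l2dotZl.
have := l2dotDr (sqsumZ a (l2val_sqsum x)) (l2val_sqsum y) (l2val_sqsum z).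
by rewrite l2dotZr.
Qed.

HB.instance Definition _ := bilinear_isBilinear.Build C l2perp l2perp
  C *%R (@Num.conj C \; *%R) l2perp_dot l2perp_dot_bilinear.

Fact l2perp_dot_hermitian x y :
  l2perp_dot x y = (-1) ^+ false * (l2perp_dot y x)^*.
Proof. by rewrite mul1r /l2perp_dot -l2dotC. Qed.

HB.instance Definition _ := isHermitianSesquilinear.Build C l2perp false
  (@Num.conj C) l2perp_dot l2perp_dot_hermitian.

Fact l2perp_dot_gt0 x : x != 0 -> 0 < l2perp_dot x x.
Proof.
move=> x0; rewrite lt_neqAle l2dot_ge0// andbT; apply: contraNneq x0 => xx0.
apply/eqP/val_inj/funext => i /=; apply/eqP; rewrite -normr_eq0.
have : `|x i| ^+ 2 == 0.
  by rewrite eq_le exprn_ge0// andbT xx0; exact: l2dot_ge.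
by rewrite expf_eq0.
Qed.

HB.instance Definition _ :=
  isDotProduct.Build C l2perp l2perp_dot l2perp_dot_gt0.

Definition l2perp_norm x : C := sqrtC (l2perp_dot x x).

Fact ler_l2perp_normD x y :
  l2perp_norm (x + y) <= l2perp_norm x + l2perp_norm y.
Proof. exact: (dot_triangle l2perp_dot). Qed.

Fact l2perp_normZ (a : C) x : l2perp_norm (a *: x) = `|a| * l2perp_norm x.
Proof.
rewrite /l2perp_norm dnormZ sqrtCM ?nnegrE ?exprn_ge0 ?dnorm_ge0//.
by rewrite sqrCK.
Qed.

Fact l2perp_norm0_eq0 x : l2perp_norm x = 0 -> x = 0.
Proof. by move/eqP; rewrite sqrtC_eq0 dnorm_eq0 => /eqP. Qed.

HB.instance Definition _ := Lmodule_isNormed.Build C l2perp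
  ler_l2perp_normD l2perp_normZ l2perp_norm0_eq0.

Fact l2perp_dot_norm x : l2perp_dot x x = `|x| ^+ 2.
Proof. by rewrite sqrtCK. Qed.

End OrthogonalComplement.

(** The inequality holds in the space [l2perp set0] of all square-summable
    families. *)
Lemma l2_CauchySchwarz (R : realType) (I : choiceType) (x y : I -> R[i]) :
  sqsum x -> sqsum y -> `|l2dot x y| ^+ 2 <= l2dot x x * l2dot y y.
Proof.
move=> x2 y2; have mem (z : I -> R[i]^o) : sqsum z -> z \in l2perp_pred set0.
  by move=> z2; apply/asboolP.
exact: (dot_CauchySchwarz (@l2perp_dot R I set0) (L2Perp (mem _ x2))
  (L2Perp (mem _ y2))).
Qed.

Section Completeness.
Variables (R : realType) (I : choiceType) (W : set (I -> R[i])).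
Local Notation C := R[i].
Local Notation l2perp := (l2perp W).
Local Notation l2perp_pred := (l2perp_pred W).
Implicit Types x y z : l2perp.
Hint Resolve l2val_sqsum : core.

Lemma l2perp_norm_coef x i : `|x i| <= `|x|.
Proof.
by rewrite -ler_sqr ?nnegrE// -l2perp_dot_norm; exact: l2dot_ge.
Qed.

(** The limit is taken coordinatewise.  If [F] is eventually in a ball of center
    [x] and radius [e], then passing to the limit in the finite sums shows that
    [x - l] has norm at most [e]: hence [l] is square-summable, orthogonal to [W]
    by the Cauchy-Schwarz inequality, and the limit of [F] in norm. *)
Fact l2perp_complete (F : set_system l2perp) :
  ProperFilter F -> cauchy F -> cvg F.
Proof.
move=> FF /cauchyP Fc.
have /choice[l Hl] (i : I) : exists li : C^o, (fun x => x i) @ F --> li.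
  have /complex_cauchy_cvg/cvg_ex[li cli] : cauchy ((fun x => x i : C^o) @ F).
    apply/cauchyP => e e0; have [x Fx] := Fc e e0; exists (x i).
    rewrite /fmap /nbhs/=; apply: filterS Fx => u; rewrite -!ball_normE/=.
    exact: le_lt_trans (l2perp_norm_coef (x - u) i).
  by exists li.
have close (x : l2perp) (e : C) : 0 < e -> F (ball x e) ->
    forall A : {fset I}, \sum_(i <- A) `|x i - l i| ^+ 2 <= e ^+ 2.
  move=> e0 Fx A; rewrite -subr_ge0; apply: near_ge0 => d d0.
  have : \sum_(i <- A) `|x i - (u : l2perp) i| ^+ 2 @[u --> F] -->
      (\sum_(i <- A) `|x i - l i| ^+ 2 : C^o).
    apply: cvg_big => [|i _]; first exact: add_continuous.
    rewrite expr2; under eq_fun do rewrite expr2.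
    have h : (`|x i - (u : l2perp) i| : C^o) @[u --> F] -->
        (`|x i - l i| : C^o).
      apply: (@cvg_norm _ C^o); apply: cvgB; first exact: cvg_cst.
      exact: Hl.
    exact: (cvgM h h).
  move/cvgrPdist_lt/(_ _ d0) => Fd.
  have [u [ud ux]] := filter_ex (filterI Fd Fx).
  exists (e ^+ 2 - \sum_(i <- A) `|x i - u i| ^+ 2).
    rewrite subr_ge0; move: ux; rewrite -ball_normE/= => ux.
    apply: le_trans (_ : `|x - u| ^+ 2 <= _); last first.
      by rewrite ler_sqr ?nnegrE// ltW.
    rewrite -l2perp_dot_norm.
    apply: (psum_le (fun i => exprn_ge0 2 (normr_ge0 ((x - u : l2perp) i)))).
    exact: l2dot_normP.
  by rewrite opprB addrC addrA subrK distrC.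
have closeS (x : l2perp) (e : C) : 0 < e -> F (ball x e) ->
    sqsum (fun i => x i - l i).
  by move=> e0 Fx; exists (e ^+ 2); exact: close.
have l2 : sqsum l.
  have [x Fx] := Fc 1 ltr01.
  have := sqsumD (l2val_sqsum x) (sqsumZ (-1) (closeS x 1 ltr01 Fx)).
  by congr sqsum; apply/funext => i; rewrite mulN1r opprB addrC subrK.
have lW : l \in l2perp_pred.
  apply/asboolP; split=> // w Ww w2; apply: small_eq0 => e e0.
  (* the Cauchy-Schwarz bound [e / (c + 1) * c] is less than [e] also if [c = 0] *)
  pose c := sqrtC (l2dot w w); have c0 : 0 <= c by rewrite sqrtC_ge0 l2dot_ge0.
  have d0 : 0 < e / (c + 1) by rewrite divr_gt0// ltr_wpDl.
  have [x Fx] := Fc _ d0.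
  have xl2 := closeS _ _ d0 Fx.
  have xw : l2dot x w = 0 by have /asboolP[_ ->] := l2valP x.
  have lw : l2dot l w = - l2dot (fun i => x i - l i) w.
    have := l2dotDl (l2val_sqsum x) (sqsumZ (-1) xl2) w2.
    rewrite l2dotZl// xw add0r mulN1r => <-; congr l2dot; apply/funext => i.
    by rewrite mulN1r opprB addrC subrK.
  rewrite lw normrN -ltr_sqr ?nnegrE ?(ltW e0)//.
  apply: le_lt_trans (l2_CauchySchwarz xl2 w2) _.
  apply: le_lt_trans (_ : (e / (c + 1)) ^+ 2 * c ^+ 2 < _).
    rewrite sqrtCK ler_wpM2r ?l2dot_ge0//.
    exact: l2dot_ler (close _ _ d0 Fx).
  rewrite -exprMn ltr_sqr ?nnegrE ?(ltW e0) ?mulr_ge0 ?(ltW d0)//.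
  rewrite mulrAC ltr_pdivrMr ?ltr_wpDl// ltr_pM2l//.
  by rewrite ltrDl.
  exact: ltW.
  by rewrite invr_ge0 addr_ge0.
apply/cvg_ex; exists (L2Perp lW); apply/cvgrPdist_lt => e e0.
have e20 : 0 < e / 2 by rewrite divr_gt0.
have [x Fx] := Fc _ e20; apply: filterS (Fx) => u; rewrite -ball_normE/= => xu.
rewrite [e]splitr; apply: le_lt_trans (_ : `|x - u| + `|x - L2Perp lW| < _).
  rewrite [leRHS]addrC (distrC x (L2Perp lW)).
  by apply: le_trans (ler_normD _ _); rewrite addrA subrK.
apply: ltr_leD => //.
rewrite -ler_sqr ?nnegrE ?(ltW e20)// -l2perp_dot_norm.
exact: l2dot_ler (close _ _ e20 Fx).
Qed.

HB.instance Definition _ := Uniform_isComplete.Build l2perp l2perp_complete.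

HB.instance Definition _ :=
  CompleteNormedModule_isHilbert.Build R l2perp (@l2perp_dot_norm R I W).

End Completeness.

(** * Square roots of operators close to the identity *)

Section Hilbert.
Variables (R : realType) (H : hilbertType R).
Local Notation C := R[i].
Implicit Types x y : H.

Lemma hdot_CauchySchwarz x y : `|'[x, y]| <= `|x| * `|y|.
Proof.
rewrite -ler_sqr ?nnegrE ?mulr_ge0// exprMn -!hdot_norm.
exact: dot_CauchySchwarz.
Qed.

Lemma hdotC x y : '[y, x] = '[x, y]^*.
Proof. by rewrite (hermC hdot y x)/= mul1r. Qed.

Lemma hdotZl (a : C) x y : '[a *: x, y] = a * '[x, y].
Proof. by rewrite linearZl_LR. Qed.

Lemma hdotZr (a : C) x y : '[x, a *: y] = a^* * '[x, y].
Proof. by rewrite linearZr_LR. Qed.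

Lemma hdotDl x y z : '[x + y, z] = '[x, z] + '[y, z].
Proof. by rewrite linearDl. Qed.

Lemma hdotDr x y z : '[x, y + z] = '[x, y] + '[x, z].
Proof. by rewrite linearDr. Qed.

Lemma hdotBl x y z : '[x - y, z] = '[x, z] - '[y, z].
Proof. by rewrite linearBl. Qed.

Lemma hdotBr x y z : '[x, y - z] = '[x, y] - '[x, z].
Proof. by rewrite linearBr. Qed.

Lemma hdot_ext x y : (forall z, '[x, z] = '[y, z]) -> x = y.
Proof.
move=> xy; apply/eqP; rewrite -subr_eq0 -normr_eq0 -sqrf_eq0.
by rewrite -hdot_norm linearBl/= xy subrr.
Qed.

(** Summing the geometric progression, [`|u m - u n|] is at most
    [c * q ^ n / (1 - q)] for [m >= n]. *)
Lemma geometric_cvg (u : nat -> H) (c : C) (q : R) :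
  0 <= q -> q < 1 -> 0 <= c ->
  (forall n, `|u n.+1 - u n| <= c * q%:C ^+ n) -> cvg (u @ \oo).
Proof.
move=> q0 q1 c0 uq; have qC0 : 0 <= q%:C by rewrite ler0c.
have q1C : 0 < 1 - q%:C by rewrite subr_gt0 ltcR.
have tail n k : `|u (n + k)%N - u n| * (1 - q%:C) <=
    c * q%:C ^+ n * (1 - q%:C ^+ k).
  elim: k => [|k IH].
    by rewrite addn0 subrr normr0 mul0r expr0 subrr mulr0.
  rewrite addnS; apply: le_trans (_ :
      (`|u (n + k).+1 - u (n + k)%N| + `|u (n + k)%N - u n|) * (1 - q%:C) <= _).
    rewrite ler_wpM2r ?(ltW q1C)//; apply: le_trans (ler_normD _ _).
    by rewrite addrA subrK.
  rewrite mulrDl; apply: le_trans (lerD (ler_wpM2r (ltW q1C) (uq _)) IH) _.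
  by rewrite exprD exprS le_eqVlt; apply/orP; left; apply/eqP; ring.
have tail' n m : (n <= m)%N -> `|u m - u n| <= c / (1 - q%:C) * q%:C ^+ n.
  move=> /subnKC <-; rewrite mulrAC ler_pdivlMr//; apply: le_trans (tail _ _) _.
  by rewrite ler_piMr ?mulr_ge0 ?exprn_ge0// gerBl exprn_ge0.
pose d := c / (1 - q%:C); have d0 : 0 <= d by rewrite divr_ge0// ltW.
suff : cauchy (u @ \oo) by exact: cauchy_cvg.
apply/cauchyP => e e0.
have ed0 : 0 < e / (d + 1) by rewrite divr_gt0// ltr_wpDl.
have edR : (complex.Re (e / (d + 1)))%:C = e / (d + 1).
  by rewrite RRe_real// gtr0_real.
have ed : 0 < complex.Re (e / (d + 1)) by rewrite -ltcR edR.
have : q ^+ n @[n --> \oo] --> (0 : R) by apply: cvg_expr; rewrite ger0_norm.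
move/cvgrPdist_lt/(_ _ ed) => [N _ HN].
exists (u N); exists N => // m /= Nm; rewrite -ball_normE/= distrC.
apply: le_lt_trans (tail' _ _ Nm) _; rewrite -/d.
have := HN N (leqnn N); rewrite /= sub0r normrN ger0_norm ?exprn_ge0//.
rewrite -ltcR edR rmorphXn/= ltr_pdivlMr ?ltr_wpDl//.
apply: le_lt_trans; rewrite mulrC ler_wpM2l ?exprn_ge0//.
by rewrite lerDl.
Qed.

Lemma bounded_continuous (K : hilbertType R) (f : {linear H -> K}) (c : C) :
  0 <= c -> (forall x, `|f x| <= c * `|x|) -> continuous f.
Proof.
move=> c0 fc x; apply/cvgrPdist_lt => e e0.
have d0 : 0 < e / (c + 1) by rewrite divr_gt0// ltr_wpDl.
have : \forall y \near x, `|x - y| < e / (c + 1).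
  by apply: (@cvgr_dist_lt _ H _ (nbhs x) _ id x) => //; exact: cvg_id.
apply: filterS => y; rewrite ltr_pdivlMr ?ltr_wpDl// => xy.
rewrite -linearB; apply: le_lt_trans (fc _) _; apply: le_lt_trans xy.
by rewrite mulrC ler_wpM2l// lerDl.
Qed.

Lemma continuous_seq (U : {linear H -> H}) (u : nat -> H) l :
  continuous U -> u n @[n --> \oo] --> l -> U (u n) @[n --> \oo] --> U l.
Proof. by move=> /(_ l) Uc ul; apply: continuous_cvg. Qed.

Section Iteration.
Variables (B : {linear H -> H}) (q : R).
Hypotheses (q0 : 0 <= q) (q1 : q < 1) (Bq : forall x, `|B x| <= q%:C * `|x|).

Let qC0 : 0 <= q%:C :> C. Proof. by rewrite ler0c. Qed.
Let qC1 : q%:C <= 1 :> C. Proof. by rewrite lecR ltW. Qed.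

(** [x] is the limit of the iterates of the contraction [x |-> y + B x]. *)
Lemma contraction_surj (y : H) : exists x, x - B x = y.
Proof.
pose u n := iter n (fun x => y + B x) 0.
have uq n : `|u n.+1 - u n| <= `|y| * q%:C ^+ n.
  elim: n => [|n IH]; first by rewrite /u/= linear0 addr0 subr0 mulr1.
  have -> : u n.+2 - u n.+1 = B (u n.+1 - u n).
    by rewrite linearB {1}/u iterS -/(u _) [X in _ - X]/u iterS -/(u _) opprD
      addrACA subrr add0r.
  apply: le_trans (Bq _) _; rewrite exprS mulrCA.
  exact: ler_wpM2l.
have /cvg_ex[x ux] := geometric_cvg q0 q1 (normr_ge0 y) uq.
exists x; apply/eqP; rewrite subr_eq eq_sym; apply/eqP.
have ux1 : u n.+1 @[n --> \oo] --> x by rewrite (cvg_shiftS u).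
have : y + B (u n) @[n --> \oo] --> y + B x.
  apply: cvgD; first exact: cvg_cst.
  by apply: continuous_seq ux; apply: (bounded_continuous qC0).
by move=> /(norm_cvg_unique ux1).
Qed.

(** Iterates of [X |-> (B + X^2) / 2] from 0.  A fixed point [X] satisfies
    [(1 - X)^2 = 1 - B]. *)
Fixpoint sqrt_iter n : H -> H :=
  if n is m.+1 then fun x => 2^-1 *: (B x + sqrt_iter m (sqrt_iter m x))
  else fun=> 0.

Lemma sqrt_iter_linear n : linear (sqrt_iter n).
Proof.
elim: n => [|n IH] a x y /=; first by rewrite scaler0 addr0.
rewrite !IH linearP scalerA mulrC -scalerA -scalerDr; congr (_ *: _).
by rewrite scalerDr addrACA.
Qed.

HB.instance Definition _ n :=
  GRing.isLinear.Build _ _ _ _ (sqrt_iter n) (sqrt_iter_linear n).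

Lemma sqrt_iter_bound n x : `|sqrt_iter n x| <= q%:C * `|x|.
Proof.
elim: n x => [|n IH] x /=; first by rewrite normr0 mulr_ge0.
rewrite normrZ gtr0_norm ?invr_gt0// mulrC ler_pdivrMr// mulr_natr mulr2n.
apply: le_trans (ler_normD _ _) _; rewrite lerD//.
apply: le_trans (IH _) _; rewrite ler_wpM2l//.
by apply: le_trans (IH _) _; rewrite ler_piMl.
Qed.

Lemma sqrt_iter_commute (U : {linear H -> H}) n :
  (forall x, U (B x) = B (U x)) ->
  forall x, U (sqrt_iter n x) = sqrt_iter n (U x).
Proof.
move=> UB; elim: n => [|n IH] x /=; first by rewrite linear0.
by rewrite linearZ/= linearD/= UB !IH.
Qed.

Lemma sqrt_iter_adj n : (forall x y, '[B x, y] = '[x, B y]) ->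
  forall x y, '[sqrt_iter n x, y] = '[x, sqrt_iter n y].
Proof.
move=> Badj; elim: n => [|n IH] x y /=; first by rewrite linear0l linear0r.
rewrite linearZl_LR linearZr_LR/= linearDl linearDr/= Badj !IH.
by rewrite fmorphV/= rmorph_nat linearDr mulrDr.
Qed.

(** From [X^2 - Y^2 = (X - Y) Y + X (X - Y)], the map [X |-> (B + X^2) / 2] has
    Lipschitz constant [q] on the operators of norm at most [q], even for
    operators that do not commute. *)
Lemma sqrt_iter_step n x :
  `|sqrt_iter n.+1 x - sqrt_iter n x| <= `|x| * q%:C ^+ n.
Proof.
elim: n x => [|n IH] x.
  rewrite [sqrt_iter 0 x]/= subr0 expr0 mulr1.
  by apply: le_trans (sqrt_iter_bound 1 _) _; rewrite ler_piMl.
rewrite [sqrt_iter n.+2]/= [X in _ - X]/=.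
set X := sqrt_iter n.+1; set Y := sqrt_iter n.
have -> : 2^-1 *: (B x + X (X x)) - 2^-1 *: (B x + Y (Y x)) =
    2^-1 *: ((X (Y x) - Y (Y x)) + X (X x - Y x)).
  rewrite -scalerBr; congr (_ *: _).
  have -> : X (X x - Y x) = X (X x) - X (Y x) by exact: linearB.
  by rewrite opprD addrACA subrr add0r [RHS]addrC addrA subrK.
rewrite normrZ gtr0_norm ?invr_gt0// mulrC ler_pdivrMr// mulr_natr mulr2n.
apply: le_trans (ler_normD _ _) _; rewrite lerD//.
  apply: le_trans (IH _) _.
  by rewrite exprS mulrA ler_wpM2r ?exprn_ge0// mulrC sqrt_iter_bound.
apply: le_trans (sqrt_iter_bound _ _) _.
by rewrite exprS mulrCA ler_wpM2l// IH.
Qed.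

Lemma sqrt_iter_cvg x : cvg (sqrt_iter n x @[n --> \oo]).
Proof.
exact: geometric_cvg q0 q1 (normr_ge0 x) (fun n => sqrt_iter_step n x).
Qed.

Definition sqrt_fix x : H := lim (sqrt_iter n x @[n --> \oo]).

Lemma sqrt_fixP x : sqrt_iter n x @[n --> \oo] --> sqrt_fix x.
Proof. exact: sqrt_iter_cvg. Qed.

Lemma sqrt_fixE x l : sqrt_iter n x @[n --> \oo] --> l -> sqrt_fix x = l.
Proof. exact: norm_cvg_lim. Qed.

Lemma sqrt_fix_linear : linear sqrt_fix.
Proof.
move=> a x y; apply: sqrt_fixE.
under eq_fun do rewrite linearP.
by apply: cvgD; [apply: cvgZl_tmp|]; exact: sqrt_fixP.
Qed.

Lemma lim_norm_ler (u : nat -> H) l (c : C) :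
  u @ \oo --> l -> (forall n, `|u n| <= c) -> `|l| <= c.
Proof.
move=> ul uc; rewrite -subr_ge0; apply: near_ge0 => e e0.
move/cvgrPdist_lt/(_ _ e0) : ul => [N _ HN].
exists (c - `|u N|); first by rewrite subr_ge0.
rewrite opprB addrC addrA subrK.
apply: le_lt_trans (ler_dist_dist _ _) _; rewrite distrC.
exact: HN (leqnn N).
Qed.

Lemma sqrt_fix_bound x : `|sqrt_fix x| <= q%:C * `|x|.
Proof.
apply: (lim_norm_ler (u := fun n => sqrt_iter n x)).
  exact: sqrt_fixP.
exact: (sqrt_iter_bound^~ x).
Qed.

Lemma sqrt_fix_eq x : sqrt_fix x = 2^-1 *: (B x + sqrt_fix (sqrt_fix x)).
Proof.
have XX : sqrt_iter n (sqrt_iter n x) @[n --> \oo] --> sqrt_fix (sqrt_fix x).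
  rewrite -[sqrt_fix (sqrt_fix x)]add0r.
  have -> : (fun n => sqrt_iter n (sqrt_iter n x)) =
      (fun n => sqrt_iter n (sqrt_iter n x - sqrt_fix x) +
                sqrt_iter n (sqrt_fix x)).
    by apply/funext => n; rewrite linearB subrK.
  apply: cvgD; last exact: sqrt_fixP.
  apply/cvgrPdist_lt => e e0; move/cvgrPdist_lt/(_ _ e0) : (@sqrt_fixP x).
  apply: filterS => n; rewrite sub0r normrN distrC; apply: le_lt_trans.
  by apply: le_trans (sqrt_iter_bound _ _) _; rewrite ler_piMl.
apply: sqrt_fixE; rewrite -(cvg_shiftS (fun n => sqrt_iter n x))/=.
by apply: cvgZl_tmp; apply: cvgD; first exact: cvg_cst.
Qed.

Lemma sqrt_fix_commute (U : {linear H -> H}) : continuous U ->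
  (forall x, U (B x) = B (U x)) -> forall x, U (sqrt_fix x) = sqrt_fix (U x).
Proof.
move=> Uc UB x; apply/esym/sqrt_fixE.
under eq_fun do rewrite -sqrt_iter_commute//.
exact: continuous_seq Uc (@sqrt_fixP x).
Qed.

(** The identity holds for the iterates; both sides are perturbed by at most
    [e / c * (`|x| + `|y|)] when [sqrt_fix] replaces [sqrt_iter n]. *)
Lemma sqrt_fix_adj : (forall x y, '[B x, y] = '[x, B y]) ->
  forall x y, '[sqrt_fix x, y] = '[x, sqrt_fix y].
Proof.
move=> Badj x y; apply/eqP; rewrite -subr_eq0; apply/eqP/small_eq0 => e e0.
pose c := `|x| + `|y| + 1; have c0 : 0 < c by rewrite ltr_wpDl ?addr_ge0.
have d0 : 0 < e / c by rewrite divr_gt0.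
have /cvgrPdist_lt/(_ _ d0) [N _ HN] := @sqrt_fixP x.
have /cvgrPdist_lt/(_ _ d0) [M _ HM] := @sqrt_fixP y.
pose n := maxn N M; have := HM n (leq_maxr _ _); have := HN n (leq_maxl _ _).
set u := _ - _; set v := _ - _ => /= xu yv.
have -> : '[sqrt_fix x, y] - '[x, sqrt_fix y] = '[u, y] - '[x, v].
  rewrite /u /v linearBl linearBr/= (sqrt_iter_adj _ Badj).
  by rewrite opprB addrA subrK.
apply: le_lt_trans (ler_normB _ _) _.
apply: le_lt_trans (lerD (hdot_CauchySchwarz _ _) (hdot_CauchySchwarz _ _)) _.
apply: le_lt_trans (_ : e / c * (`|x| + `|y|) < _).
  rewrite mulrDr [leLHS]addrC (mulrC `|x| `|v|).
  by apply: lerD; (apply: ler_wpM2r; [exact: normr_ge0|exact: ltW]).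
by rewrite mulrAC ltr_pdivrMr// ltr_pM2l// ltrDl.
Qed.

(** ['[sqrt_fix x, x]] is real by self-adjointness and at most [q * `|x| ^+ 2]. *)
Lemma sqrt_fix_dot_le x : (forall x y, '[B x, y] = '[x, B y]) ->
  0 <= '[x - sqrt_fix x, x].
Proof.
move=> Badj; rewrite linearBl/= subr_ge0 hdot_norm.
have Xreal : '[sqrt_fix x, x] \is Num.real.
  by rewrite CrealE; apply/eqP; rewrite -hdotC -sqrt_fix_adj.
apply: le_trans (real_ler_norm Xreal) _.
apply: le_trans (hdot_CauchySchwarz _ _) _.
rewrite expr2 ler_wpM2r//; apply: le_trans (sqrt_fix_bound _) _.
by rewrite ler_piMl.
Qed.

End Iteration.

(** The root is [sqrt b (1 - X)], with [X] the fixed point of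
    [X |-> (B + X^2) / 2].  Besides being a positive root it is onto, as [X] is a
    strict contraction, and it commutes with every continuous operator that
    commutes with [B], as [X] is a pointwise limit of polynomials in [B]. *)
Lemma positive_sqrt_exists (S : H -> H) (b q : R) (B : {linear H -> H}) :
  0 < b -> 0 <= q -> q < 1 -> (forall x, `|B x| <= q%:C * `|x|) ->
  (forall x y, '[B x, y] = '[x, B y]) ->
  (forall x, S x = b%:C *: (x - B x)) ->
  exists T : {linear H -> H},
    [/\ is_positive_sqrt S T,
        forall y, exists x, T x = y,
        forall x y, '[T x, y] = '[x, T y] &
        forall U : {linear H -> H}, continuous U ->
          (forall x, U (B x) = B (U x)) -> forall x, U (T x) = T (U x)].
Proof.
move=> b0 q0 q1 Bq Badj SB.
pose X : {linear H -> H} := HB.pack (sqrt_fix B)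
  (GRing.isLinear.Build _ _ _ _ _ (sqrt_fix_linear q0 q1 Bq)).
pose s : C := (Num.sqrt b)%:C.
have s0 : 0 < s by rewrite ltcR sqrtr_gt0.
have sE : s * s = b%:C by rewrite -rmorphM/= -expr2 sqr_sqrtr// ltW.
have Tlin : linear (fun x => s *: (x - X x)).
  move=> a x y; rewrite linearP scalerA mulrC -scalerA -scalerDr.
  by congr (_ *: _); rewrite scalerBr opprD addrACA.
pose T : {linear H -> H} :=
  HB.pack (fun x => s *: (x - X x)) (GRing.isLinear.Build _ _ _ _ _ Tlin).
have TE x : T x = s *: (x - X x) by [].
have Xq x : `|X x| <= q%:C * `|x| := sqrt_fix_bound q0 q1 Bq x.
have qC0 : 0 <= q%:C :> C by rewrite ler0c.
exists T; split.
- split.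
  + apply: (@bounded_continuous H T (s * (1 + q%:C))).
      by rewrite mulr_ge0 ?addr_ge0// ltW.
    move=> x; rewrite TE normrZ gtr0_norm// -mulrA ler_pM2l//.
    by apply: le_trans (ler_normB _ _) _; rewrite mulrDl mul1r lerD.
  + move=> x; rewrite TE linearZl_LR mulr_ge0 ?(ltW s0)//.
    exact: (sqrt_fix_dot_le q0 q1 Bq x Badj).
  + move=> x; rewrite !TE.
    have -> : X (s *: (x - X x)) = s *: (X x - X (X x)).
      by rewrite linearZ_LR linearB.
    rewrite -scalerBr scalerA sE SB; congr (_ *: _).
    have XX : X x + X x = B x + X (X x).
      have /(congr1 (fun z => (2 : C) *: z)) := sqrt_fix_eq q0 q1 Bq x.
      by rewrite scalerA divff ?pnatr_eq0// scale1r scaler_nat mulr2n.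
    have -> : B x = X x + X x - X (X x) by rewrite XX addrK.
    by rewrite !opprB opprD -addrA; congr (_ + _); rewrite addrCA.
- move=> y; have [x xy] := contraction_surj q0 q1 Xq (s^-1 *: y).
  by exists x; rewrite TE xy scalerA divff ?scale1r ?gt_eqF.
- move=> x y; have adj : '[x - X x, y] = '[x, y - X y].
    rewrite hdotBl hdotBr; congr (_ - _).
    exact: sqrt_fix_adj q0 q1 Bq Badj _ _.
  by rewrite !TE hdotZl hdotZr adj geC0_conj// ltW.
- move=> U Uc UB x; rewrite !TE linearZ/= linearB/=.
  by congr (_ *: (_ - _)); apply: (sqrt_fix_commute q0 q1 Bq _ UB).
Qed.

End Hilbert.

(** * Frame operators *)

Section Bessel.
Variables (R : realType) (H : hilbertType R) (I : choiceType) (F : I -> H).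
Local Notation C := R[i].
Implicit Types x y : H.

Definition frame_coef x : I -> C := fun i => '[x, F i].

Lemma frame_coef_linear a x y :
  frame_coef (a *: x + y) = (fun i => a * frame_coef x i + frame_coef y i).
Proof. by apply/funext => i; rewrite /frame_coef hdotDl hdotZl. Qed.

Lemma sqnorm_real (V : normedZmodType C) (z : V) :
  (complex.Re (`|z| ^+ 2))%:C = `|z| ^+ 2.
Proof. by rewrite RRe_real// rpredX// normr_real. Qed.

Lemma Re_sqnorm_ge0 (z : C) : 0 <= complex.Re (`|z| ^+ 2).
Proof. by rewrite -lecR sqnorm_real exprn_ge0. Qed.

Definition parseval_sum :=
  forall x, has_sum (fun i => `|frame_coef x i| ^+ 2) (`|x| ^+ 2).

Lemma frame_sumE x s : has_sum (fun i => `|frame_coef x i| ^+ 2) s ->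
  frame_sum F x = (complex.Re s)%:E.
Proof.
move=> xs; apply: has_sum_esum => [i|]; first exact: Re_sqnorm_ge0.
rewrite RRe_real; first by apply: eq_has_sum xs => i; rewrite sqnorm_real.
have := psum_le (fun i => exprn_ge0 2 (normr_ge0 (frame_coef x i))) fset0 xs.
by rewrite big_seq_fset0 => /ger0_real.
Qed.

Lemma parseval_sum_frame : parseval_sum -> parseval_frame F.
Proof. by move=> P x; rewrite (frame_sumE (P x)) !mul1r. Qed.

Definition bessel_bound (b : R) := forall x (A : {fset I}),
  \sum_(i <- A) `|frame_coef x i| ^+ 2 <= b%:C * `|x| ^+ 2.

Lemma frame_bessel a b : frame_bounds a b F ->
  bessel_bound b.
Proof.
move=> ab x A; have [_ xb] := ab x.
under eq_bigr do rewrite -sqnorm_real.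
rewrite sum_real_complex -sqnorm_real -rmorphM/= lecR -lee_fin.
by apply: le_trans xb; apply: esum_ge_psum => i; exact: Re_sqnorm_ge0.
Qed.

Section Operator.
Variable b : R.
Hypothesis b0 : 0 < b.
Hypothesis bessel : bessel_bound b.

Let bC0 : 0 < b%:C :> C. Proof. by rewrite ltcR. Qed.

Lemma frame_coef_sqsum x : sqsum (frame_coef x).
Proof. by exists (b%:C * `|x| ^+ 2); exact: bessel. Qed.
Hint Resolve frame_coef_sqsum : core.

(** With [v] the sum on the left, [|v|^2] is the sum of the
    [c i * (frame_coef v i)^*]; the inequality between arithmetic and geometric
    means, weighted by [b], bounds [2 |v|^2] by [b \sum_i |c i|^2 + |v|^2], where
    the last term comes from the Bessel bound for [v]. *)
Lemma synthesis_bound (c : I -> C) (A : {fset I}) :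
  `|\sum_(i <- A) c i *: F i| ^+ 2 <= b%:C * \sum_(i <- A) `|c i| ^+ 2.
Proof.
set v := \sum_(i <- A) _.
have amgm (s t : C) : `|s * t| *+ 2 <= b%:C * `|s| ^+ 2 + b%:C^-1 * `|t| ^+ 2.
  rewrite normrM -subr_ge0.
  have -> : b%:C * `|s| ^+ 2 + b%:C^-1 * `|t| ^+ 2 - (`|s| * `|t|) *+ 2 =
      b%:C * (`|s| - b%:C^-1 * `|t|) ^+ 2.
    by field; rewrite gt_eqF.
  rewrite mulr_ge0 ?(ltW bC0)// real_exprn_even_ge0// rpredB ?normr_real//.
  by rewrite rpredM ?normr_real// rpredV gtr0_real.
have vv : `|v| ^+ 2 = \sum_(i <- A) c i * (frame_coef v i)^*.
  rewrite -hdot_norm {1}/v linear_sumlz; apply: eq_bigr => i _.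
  rewrite /= hdotZl [in RHS]/frame_coef -hdotC //.
have : `|v| ^+ 2 *+ 2 <= b%:C * \sum_(i <- A) `|c i| ^+ 2 + `|v| ^+ 2.
  rewrite -{1}(ger0_norm (exprn_ge0 2 (normr_ge0 v))) vv.
  apply: le_trans (_ : (\sum_(i <- A) `|c i * (frame_coef v i)^*|) *+ 2 <= _).
    by rewrite ler_pMn2r// ler_norm_sum.
  rewrite -sumrMnl.
  apply: le_trans (_ : \sum_(i <- A)
      (b%:C * `|c i| ^+ 2 + b%:C^-1 * `|frame_coef v i| ^+ 2) <= _).
    by apply: ler_sum => i _; rewrite -(norm_conjC (frame_coef v i)) amgm.
  rewrite big_split/= -!mulr_sumr -vv lerD2l mulrC ler_pdivrMr// mulrC.
  exact: bessel.
by rewrite mulr2n lerD2r.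
Qed.

Lemma frame_operator_has_sum x :
  has_sum (fun i => frame_coef x i *: F i) (frame_operator F x).
Proof.
have [s xs] : exists s, has_sum (fun i => frame_coef x i *: F i) s.
  apply: (@dominated_has_sum _ _ _ _ (fun i => `|frame_coef x i| ^+ 2)
    (l2dot (frame_coef x) (frame_coef x))).
  - by move=> G PG; exact: cauchy_cvg.
  - by move=> i; rewrite exprn_ge0.
  - exact: l2dot_normP.
  move=> e e0; exists (e ^+ 2 / b%:C); first by rewrite divr_gt0// exprn_gt0.
  move=> A; rewrite ltr_pdivlMr// => h; rewrite -ltr_sqr ?nnegrE ?(ltW e0)//.
  by apply: le_lt_trans (synthesis_bound _ _) _; rewrite mulrC.
by rewrite /frame_operator (has_sum_summability xs).
Qed.

Lemma frame_operator_dot x y :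
  '[frame_operator F x, y] = l2dot (frame_coef x) (frame_coef y).
Proof.
apply/esym/l2dotE.
have dotD : {morph (fun z : H => '[z, y]) : u v / u + v}.
  by move=> u v; rewrite linearDl.
have dot_le (u : H) : `|'[u, y]| <= `|y| * `|u|.
  by rewrite mulrC hdot_CauchySchwarz.
have := has_sum_map (normr_ge0 y) dotD dot_le (frame_operator_has_sum x).
by apply: eq_has_sum => i; rewrite hdotZl/= -hdotC.
Qed.

Lemma frame_operator_linear : linear (frame_operator F).
Proof.
move=> a x y; apply: hdot_ext => z.
rewrite hdotDl hdotZl !frame_operator_dot frame_coef_linear.
rewrite -l2dotZl// l2dotDl//.
exact: sqsumZ.
Qed.

Lemma frame_operator_adj x y :
  '[frame_operator F x, y] = '[x, frame_operator F y].
Proof. by rewrite (hdotC (frame_operator F y)) !frame_operator_dot -l2dotC. Qed.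

(** The synthesis bound applied to [c := frame_coef x]. *)
Lemma frame_operator_bound x :
  `|frame_operator F x| ^+ 2 <= b%:C * '[frame_operator F x, x].
Proof.
rewrite frame_operator_dot; set d := l2dot _ _.
have d0 : 0 <= b%:C * d by rewrite mulr_ge0 ?l2dot_ge0// ltW.
rewrite -(sqrtCK (b%:C * d)) ler_sqr ?nnegrE ?sqrtC_ge0//.
apply: has_sum_norm_ler (frame_operator_has_sum x) _ => A.
rewrite -ler_sqr ?nnegrE ?sqrtC_ge0// sqrtCK.
apply: le_trans (synthesis_bound _ _) _; rewrite ler_pM2l//.
apply: psum_le; last exact: l2dot_normP.
by move=> i; rewrite exprn_ge0.
Qed.

End Operator.
End Bessel.

Section FrameSqrt.
Variables (R : realType) (H : hilbertType R) (I : choiceType) (F : I -> H).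
Local Notation C := R[i].
Implicit Types x y : H.

(** [B := 1 - S / b] satisfies
    [|B x|^2 = |x|^2 - 2 '[S x, x] / b + |S x|^2 / b^2 <= |x|^2 - '[S x, x] / b],
    which the lower frame bound makes at most [(1 - a / b) |x|^2]; so [B] has norm
    less than 1 and [S = b (1 - B)]. *)
Lemma frame_operator_sqrt : is_frame F ->
  exists T : {linear H -> H},
    [/\ is_positive_sqrt (frame_operator F) T,
        forall y, exists x, T x = y,
        forall x y, '[T x, y] = '[x, T y] &
        forall U : {linear H -> H}, continuous U ->
          (forall x, U (frame_operator F x) = frame_operator F (U x)) ->
          forall x, U (T x) = T (U x)].
Proof.
move=> [a [b [a0 ab abF]]].
have b0 : 0 < b by exact: lt_le_trans ab.
have bC0 : 0 < b%:C :> C by rewrite ltcR.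
have bessel := frame_bessel abF.
pose S := frame_operator F.
have Slin : linear S := frame_operator_linear b0 bessel.
have lower x : a%:C * `|x| ^+ 2 <= '[S x, x].
  rewrite (frame_operator_dot b0 bessel).
  have x2 := frame_coef_sqsum bessel x.
  have [h _] := abF x; move: h; rewrite (frame_sumE (l2dot_normP x2)) lee_fin.
  rewrite -lecR rmorphM/= sqnorm_real RRe_real// ger0_real//.
  exact: l2dot_ge0.
pose B0 x := x - b%:C^-1 *: S x.
have Blin : linear B0.
  move=> c x y; rewrite /B0 Slin scalerDr scalerA mulrC -scalerA opprD addrACA.
  by rewrite -scalerBr.
pose B : {linear H -> H} := HB.pack B0 (GRing.isLinear.Build _ _ _ _ _ Blin).
have BE x : B x = x - b%:C^-1 *: S x by [].
pose q := Num.sqrt (1 - a / b).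
have ab1 : 0 <= 1 - a / b by rewrite subr_ge0 ler_pdivrMr// mul1r.
have q0 : 0 <= q by rewrite sqrtr_ge0.
have q1 : q < 1.
  by rewrite -sqrtr1 ltr_sqrt// gtrBl divr_gt0.
have qE : q%:C ^+ 2 = 1 - a%:C / b%:C :> C.
  by rewrite -rmorphXn/= sqr_sqrtr// rmorphB/= fmorph_div.
have qC0 : 0 <= q%:C :> C by rewrite ler0c.
have bV : (b%:C^-1)^* = b%:C^-1 :> C by rewrite geC0_conj// invr_ge0 ltW.
have Bq x : `|B x| <= q%:C * `|x|.
  rewrite -ler_sqr ?nnegrE ?mulr_ge0// exprMn qE.
  have Sxx := frame_operator_adj b0 bessel x x.
  rewrite -hdot_norm BE hdotBl !hdotBr !hdotZl !hdotZr bV -Sxx -!hdot_norm.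
  have Sb := frame_operator_bound b0 bessel x.
  have -> : '[x, x] - b%:C^-1 * '[S x, x] -
      (b%:C^-1 * '[S x, x] - b%:C^-1 * (b%:C^-1 * '[S x, S x])) =
      '[x, x] - b%:C^-1 * '[S x, x] -
      b%:C^-1 * ('[S x, x] - b%:C^-1 * '[S x, S x]) by ring.
  apply: le_trans (_ : '[x, x] - b%:C^-1 * '[S x, x] <= _).
    rewrite gerBl mulr_ge0 ?invr_ge0 ?(ltW bC0)// subr_ge0.
    by rewrite mulrC ler_pdivrMr// hdot_norm mulrC.
  rewrite mulrBl mul1r lerD2l lerN2 mulrAC mulrC ler_pM2l ?invr_gt0//.
  by rewrite hdot_norm.
have Badj x y : '[B x, y] = '[x, B y].
  by rewrite !BE hdotBl hdotBr hdotZl hdotZr bV (frame_operator_adj b0 bessel).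
have SB x : S x = b%:C *: (x - B x).
  by rewrite BE opprB addrC subrK scalerA divff ?gt_eqF// scale1r.
have [T [Tsqrt Tsurj Tadj Tcomm]] := positive_sqrt_exists b0 q0 q1 Bq Badj SB.
exists T; split=> // U Uc US; apply: Tcomm => // x.
by rewrite !BE linearB/= linearZ_LR/= US.
Qed.

End FrameSqrt.

(** * Translations twisted by a multiplier *)

Section Twist.
Variables (R : realType) (G : groupType) (mu : G -> G -> R[i]).
Hypothesis mu_mult : multiplier mu.
Local Notation C := R[i].
Implicit Types (k l : G -> C) (g h : G).

(** The left regular [mu]-projective representation on functions: it sends the
    indicator of [h] to [mu g h] times the indicator of [g * h]. *)
Definition twisted_shift g k : G -> C :=
  fun h => mu g (g^-1 * h)%g * k (g^-1 * h)%g.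

Lemma multiplier_mul_conj g h : mu g h * (mu g h)^* = 1.
Proof. by have [mu1 _ _] := mu_mult; rewrite -normCK mu1 expr1n. Qed.

Lemma has_sum_sqsum k s : has_sum (fun g => `|k g| ^+ 2) s -> sqsum k.
Proof.
move=> ks; exists s => A.
exact: (psum_le (fun g => exprn_ge0 2 (normr_ge0 (k g)))).
Qed.

Lemma l2dot_shift_sum g k l s : has_sum (fun h => k h * (l h)^*) s ->
  has_sum (fun h => twisted_shift g k h * (twisted_shift g l h)^*) s.
Proof.
move=> kls; have := has_sum_reindex (mulVKg g) (mulKg g) kls.
apply: eq_has_sum => h; rewrite /twisted_shift rmorphM/= mulrACA.
by rewrite multiplier_mul_conj mul1r.
Qed.

Lemma twisted_shift_sqsum g k : sqsum k -> sqsum (twisted_shift g k).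
Proof.
move=> k2; apply: (@has_sum_sqsum _ (l2dot k k)).
by apply: eq_has_sum (l2dot_shift_sum g (l2dotP k2 k2)) => h; rewrite normCK.
Qed.

Lemma l2dot_shift g k l : sqsum k -> sqsum l ->
  l2dot (twisted_shift g k) (twisted_shift g l) = l2dot k l.
Proof. by move=> k2 l2; apply/l2dotE/l2dot_shift_sum/l2dotP. Qed.

Lemma twisted_shiftM g h k :
  twisted_shift g (twisted_shift h k) =
  (fun t => mu g h * twisted_shift (g * h)%g k t).
Proof.
apply/funext => t; rewrite /twisted_shift mulrA mulrA invgM -mulgA.
congr (_ * _).
have [_ mu_cocycle _] := mu_mult.
have := mu_cocycle g h (h^-1 * (g^-1 * t))%g.
by rewrite mulVKg => ->; rewrite mulrC.
Qed.

Lemma twisted_shift_delta g :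
  twisted_shift g (fun h => (h == 1%g)%:R) = (fun h => (h == g)%:R).
Proof.
have [_ _ mu1] := mu_mult.
apply/funext => h; rewrite /twisted_shift -(inj_eq (mulgI g)) mulVKg mulg1.
by case: eqP => [->|_]; rewrite ?mulr0// mulVg (mu1 g).1 mulr1.
Qed.

Lemma twisted_shift1 k : twisted_shift 1%g k = k.
Proof.
have [_ _ mu1] := mu_mult.
by apply/funext => h; rewrite /twisted_shift invg1 mul1g (mu1 h).2 mul1r.
Qed.

Section Coef.
Variables (H : hilbertType R) (pi : G -> {linear H -> H}).
Hypothesis pi_rep : projective_representation mu pi.

(** Taking frame coefficients along an orbit intertwines the representation with
    the twisted translations: [pi h v] is [pi g (pi (g^-1 h) v)] up to a unimodular
    factor, and [pi g] preserves the inner product. *)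
Lemma frame_coef_rep v g x :
  frame_coef (fun h => pi h v) (pi g x) =
  twisted_shift g (frame_coef (fun h => pi h v) x).
Proof.
have [_ piU piM] := pi_rep.
apply/funext => h; rewrite /frame_coef /twisted_shift.
rewrite -((piU g).2 x) piM hdotZr mulVKg mulrA.
by rewrite multiplier_mul_conj mul1r.
Qed.

Lemma unitary_norm (U : {linear H -> H}) x : unitary U -> `|U x| = `|x|.
Proof.
case=> _ UU; apply/eqP.
by rewrite -(@eqrXn2 _ 2)// -!hdot_norm UU.
Qed.

Lemma unitary_continuous (U : {linear H -> H}) : unitary U -> continuous U.
Proof.
move=> UU; apply: (@bounded_continuous _ _ _ _ 1) => // x.
by rewrite mul1r unitary_norm.
Qed.

(** Since [pi g] is onto, it suffices to compare the inner products with the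
    vectors [pi g y]; both are inner products of frame coefficients, and twisted
    translations preserve those. *)
Lemma frame_operator_commute v b g x : 0 < b ->
  bessel_bound (fun h => pi h v) b ->
  pi g (frame_operator (fun h => pi h v) x) =
  frame_operator (fun h => pi h v) (pi g x).
Proof.
move=> b0 bessel; have [_ piU _] := pi_rep; apply: hdot_ext => y.
have [[pi' _ pi'K] UU] := piU g.
have cs := frame_coef_sqsum bessel.
rewrite -(pi'K y) UU !(frame_operator_dot b0 bessel) !frame_coef_rep.
by rewrite l2dot_shift.
Qed.

End Coef.
End Twist.

(** * Orthonormal bases *)

Section OrthonormalBasis.
Variables (R : realType) (L : hilbertType R) (I : choiceType) (E : I -> L).

(** The distance of [u] to the partial sum of its expansion over [A] has square
    [|u|^2 - \sum_(i in A) |'[u, E i]|^2], which tends to 0. *)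
Lemma parseval_orthonormal_basis :
  orthonormal_family E -> parseval_sum E -> orthonormal_basis E.
Proof.
move=> orth P; split=> //; apply/seteqP; split=> // u _ N.
rewrite /= -nbhs_ballE => -[e /= e0 eN].
have e20 : 0 < e ^+ 2 by rewrite exprn_gt0.
have [A HA] := P u _ e20; have := HA _ (fsubset_refl _) => {HA} HA.
pose p := \sum_(i <- A) frame_coef E u i *: E i.
exists p; split; first by exists A, (frame_coef E u).
apply: eN; rewrite -ball_normE/=.
have pE j : j \in A -> '[p, E j] = frame_coef E u j.
  move=> jA; rewrite linear_sumlz (big_fsetD1 j)//= hdotZl orth eqxx mulr1.
  rewrite big_seq big1 ?addr0// => i; rewrite !inE => /andP[ij _].
  by rewrite hdotZl orth (negPf ij) mulr0.
have up : '[u - p, p] = 0.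
  rewrite {2}/p linear_sumr/= big_seq big1// => i iA.
  by rewrite hdotZr hdotBl pE// subrr mulr0.
have upu : '[u - p, u - p] = `|u| ^+ 2 - \sum_(i <- A) `|frame_coef E u i| ^+ 2.
  rewrite hdotBr up subr0 hdotBl hdot_norm; congr (_ - _).
  rewrite linear_sumlz; apply: eq_bigr => i _ /=.
  by rewrite hdotZl normCK [in RHS]/frame_coef -(hdotC u).
rewrite -ltr_sqr ?nnegrE ?(ltW e0)// -hdot_norm upu.
apply: le_lt_trans HA; rewrite real_ler_norm// rpredB ?rpredX ?normr_real//.
by apply: rpred_sum => i _; rewrite rpredX ?normr_real.
Qed.

End OrthonormalBasis.

(** * The complementary representation *)

Section Dilation.
Variables (R : realType) (G : groupType) (mu : G -> G -> R[i]).
Variables (H : hilbertType R) (pi : G -> {linear H -> H}) (v : H).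
Local Notation C := R[i].
Hypothesis pi_rep : projective_representation mu pi.
Local Notation F := (fun g => pi g v).
Hypothesis P : parseval_sum F.

Let mu_mult : multiplier mu. Proof. by case: pi_rep. Qed.

Local Notation theta := (frame_coef F).

Lemma theta_sqsum x : sqsum (theta x).
Proof. exact: has_sum_sqsum (P x). Qed.
Hint Resolve theta_sqsum : core.

Lemma theta_norm x : l2dot (theta x) (theta x) = '[x, x].
Proof. by rewrite (l2dot_normE (P x)) hdot_norm. Qed.

(** Polarization: the two sesquilinear forms agree on the diagonal, so the
    expansion of both at [a *: x + y] gives, for [a = 1] and [a = 'i], two
    equations that determine the off-diagonal value. *)
Lemma theta_dot x y : l2dot (theta x) (theta y) = '[x, y].
Proof.
have expand a :
    a * l2dot (theta x) (theta y) + a^* * l2dot (theta y) (theta x) =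
    a * '[x, y] + a^* * '[y, x].
  have := theta_norm (a *: x + y); rewrite frame_coef_linear.
  have ax2 : sqsum (fun i => a * theta x i) by exact: sqsumZ.
  have axy2 := sqsumD ax2 (theta_sqsum y).
  rewrite l2dotDl// !l2dotDr// !l2dotZl// !l2dotZr// !theta_norm.
  rewrite hdotDl !hdotDr !hdotZl !hdotZr => h.
  apply: (@addrI _ (a * (a^* * '[x, x]))); apply: (@addIr _ '[y, y]).
  by move: h; rewrite !addrA.
have e1 := expand 1; have ei := expand 'i%C.
have conji : ('i%C : C)^* = - 'i%C.
  by apply/eqP; rewrite eq_complex /= oppr0 !eqxx.
have ii : 'i%C * 'i%C = -1 :> C by rewrite -expr2 sqr_i.
move: e1 ei; rewrite conjC1 !mul1r conji !mulNr.
move=> e1 /(congr1 ( *%R 'i%C)); rewrite !mulrBr !mulrA ii !mulN1r !opprK => ei.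
have twice (p q : C) : p + q - (- p + q) = 2 * p by ring.
apply: (@mulfI _ (2 : C)); rewrite ?pnatr_eq0//.
by have := congr2 (fun p q : C => p - q) e1 ei; rewrite !twice.
Qed.

(** Twisted translations are unitary and permute the range of [theta], so they
    preserve its complement. *)
Lemma twisted_shift_perp g k : k \in l2perp_pred (range theta) ->
  twisted_shift mu g k \in l2perp_pred (range theta).
Proof.
move=> /asboolP[k2 kW]; apply/asboolP; split; first exact: twisted_shift_sqsum.
move=> _ [y _ <-] _; have [_ piU _] := pi_rep.
have [[pi' _ pi'K] _] := piU g.
rewrite -(pi'K y) (frame_coef_rep mu_mult pi_rep) l2dot_shift//.
by apply: kW => //; exists (pi' y).
Qed.

Definition dilation_space : hilbertType R := l2perp (range theta).

Definition dilation_act g (k : dilation_space) : dilation_space :=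
  L2Perp (twisted_shift_perp g (l2valP k)).

Lemma dilation_act_linear g : linear (dilation_act g).
Proof.
move=> a x y; apply/val_inj/funext => h /=.
by rewrite /twisted_shift mulrDr mulrCA.
Qed.

HB.instance Definition _ g := GRing.isLinear.Build _ _ _ _ (dilation_act g)
  (dilation_act_linear g).

Lemma dilation_dot g k l : '[dilation_act g k, dilation_act g l] = '[k, l].
Proof. by apply: (l2dot_shift mu_mult); exact: l2val_sqsum. Qed.

Lemma dilation_actM g h k :
  dilation_act g (dilation_act h k) = mu g h *: dilation_act (g * h)%g k.
Proof. by apply: val_inj => /=; rewrite twisted_shiftM. Qed.

Lemma dilation_act1 k : dilation_act 1%g k = k.
Proof. by apply: val_inj => /=; rewrite twisted_shift1. Qed.

Lemma dilation_rep : projective_representation mu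
  (fun g => dilation_act g : {linear dilation_space -> dilation_space}).
Proof.
split=> // [g|g h k]; last exact: dilation_actM.
have [mu1 _ _] := mu_mult.
split; last exact: dilation_dot.
have act_inj : injective (dilation_act g).
  move=> k l kl; apply/eqP; rewrite -subr_eq0 -normr_eq0 -sqrf_eq0 -hdot_norm.
  by rewrite -(dilation_dot g) linearB/= kl subrr linear0l.
pose inv k := (mu g g^-1%g)^-1 *: dilation_act g^-1%g k.
have invK : cancel inv (dilation_act g).
  move=> k; rewrite /inv linearZ/= dilation_actM mulgV dilation_act1 scalerA.
  by rewrite mulVf ?scale1r// -normr_eq0 mu1 oner_eq0.
by exists inv => // k; apply: act_inj; rewrite invK.
Qed.

(** The component orthogonal to the range of [theta] of the indicator of [g]:
    both this indicator and [theta (pi g v)] have inner product ['[pi g v, y]]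
    with [theta y], so [theta (pi g v)] is its projection on the range. *)
Definition delta_defect g : G -> C := fun h => (h == g)%:R - theta (pi g v) h.

Lemma delta_sqsum g : sqsum (fun h : G => (h == g)%:R : C).
Proof.
apply: (@has_sum_sqsum _ _ _ (`|(g == g)%:R : C| ^+ 2)).
apply: (@has_sum_single _ _ C (fun h : G => `|(h == g)%:R : C| ^+ 2) g).
move=> h /negPf ->.
by rewrite normr0 expr0n.
Qed.

Lemma l2dot_delta (k : G -> C) g : l2dot k (fun h : G => (h == g)%:R : C) = k g.
Proof.
apply: l2dotE.
have := @has_sum_single _ _ C (fun h : G => k h * ((h == g)%:R : C)^*) g.
by rewrite eqxx conjC1 mulr1; apply=> h /negPf ->; rewrite conjC0 mulr0.
Qed.

Lemma delta_defectE g :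
  delta_defect g = (fun h => (h == g)%:R + -1 * theta (pi g v) h).
Proof. by apply/funext => h; rewrite mulN1r. Qed.

Lemma delta_defect_perp g : delta_defect g \in l2perp_pred (range theta).
Proof.
have d2 := delta_sqsum g; have t2 := sqsumZ (-1) (theta_sqsum (pi g v)).
apply/asboolP; rewrite delta_defectE; split; first exact: sqsumD.
move=> _ [y _ <-] _; rewrite l2dotDl// l2dotZl// theta_dot l2dotC//.
by rewrite l2dot_delta /frame_coef -hdotC mulN1r subrr.
Qed.

Definition dilation_vector : dilation_space := L2Perp (delta_defect_perp 1%g).

Lemma dilation_orbit g :
  dilation_act g dilation_vector = L2Perp (delta_defect_perp g).
Proof.
apply: val_inj => /=; rewrite /delta_defect.
have -> : theta (pi g v) = twisted_shift mu g (theta (pi 1%g v)).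
  have [[_ _ mu1] _ piM] := pi_rep.
  by rewrite -(frame_coef_rep mu_mult pi_rep) piM mulg1 (mu1 g).1 scale1r.
apply/funext => h; have /(congr1 (@^~ h))/= <- := twisted_shift_delta mu_mult g.
by rewrite /twisted_shift mulrBr.
Qed.

(** The orbit of [dilation_vector] reproduces the values of the elements of the
    complement: [theta (pi g v)] is orthogonal to [k], so only the indicator of
    [g] contributes. *)
Lemma dot_dilation_orbit (k : dilation_space) g :
  '[k, dilation_act g dilation_vector] = (k : G -> C) g.
Proof.
rewrite dilation_orbit /hdot/= /l2perp_dot/= delta_defectE.
have k2 := l2val_sqsum k; have t2 := theta_sqsum (pi g v).
rewrite l2dotDr//; last exact: sqsumZ; last exact: delta_sqsum.
rewrite l2dotZr// l2dot_delta.
have /asboolP[_ kW] := l2valP k; by rewrite kW ?mulr0 ?addr0.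
Qed.

Lemma dilation_parseval :
  parseval_sum (fun g => dilation_act g dilation_vector).
Proof.
move=> k; rewrite -hdot_norm.
apply: eq_has_sum (l2dot_normP (l2val_sqsum k)) => g.
by rewrite /frame_coef dot_dilation_orbit.
Qed.

(** The [h]-th coordinate of [delta_defect g] is [(h == g)%:R] minus
    ['[pi g v, pi h v]], and the second term cancels the contribution of [H]. *)
Lemma dilation_orthonormal :
  orthonormal_family (fun g => hpair (pi g v) (dilation_act g dilation_vector)).
Proof.
move=> g h; rewrite /hdot/= /hsum_dot/= dot_dilation_orbit dilation_orbit/=.
by rewrite /delta_defect /frame_coef addrC subrK eq_sym.
Qed.

(** The coefficients of the pair [(x, k)] are those of the sum of the two
    orthogonal families [theta x] and [k], whose squared norm is
    [|x|^2 + |k|^2]. *)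
Lemma dilation_hsum_parseval :
  parseval_sum (fun g => hpair (pi g v) (dilation_act g dilation_vector)).
Proof.
move=> [x k]; rewrite -hdot_norm /hdot/= /hsum_dot/=.
have x2 := theta_sqsum x; have k2 := l2val_sqsum k.
have kx : l2dot k (theta x) = 0.
  by have /asboolP[_ kW] := l2valP k; apply: kW => //; exists x.
have := l2dot_normP (sqsumD x2 k2).
rewrite l2dotDl ?l2dotDr//; try exact: sqsumD.
rewrite theta_norm kx add0r (l2dotC k2 x2) kx conjC0 addr0.
apply: eq_has_sum => g.
by rewrite [in RHS]/frame_coef /hdot/= /hsum_dot/= dot_dilation_orbit.
Qed.

End Dilation.

(** * Parseval frames and dilation of frame representations *)

Theorem theorem3p1 (R : realType) (G : groupType) (H : hilbertType R)
  (mu : G -> G -> R[i]) (pi : G -> {linear H -> H}) (f : H)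
  (countableG : countable [set: G]) (separableH : separable H)
  (pi_rep : projective_representation mu pi)
  (pif_frame : is_frame (fun g => pi g f)) :
  exists f1 : H,
    [/\ parseval_frame (fun g => pi g f1),
        exists T : {linear H -> H},
          is_positive_sqrt (frame_operator (fun g => pi g f)) T /\
          forall g, T (pi g f1) = pi g f
      & exists (K : hilbertType R) (pi' : G -> {linear K -> K}) (f2 : K),
          [/\ projective_representation mu pi',
              parseval_frame (fun g => pi' g f2)
            & orthonormal_basis (fun g => hpair (pi g f1) (pi' g f2))]].
Proof.
have [T [Tsqrt Tsurj Tadj Tcomm]] := frame_operator_sqrt pif_frame.
have [a [b [a0 ab abF]]] := pif_frame; have bessel := frame_bessel abF.
have b0 : 0 < b by exact: lt_le_trans ab.
have [mu_mult piU _] := pi_rep.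
have [f1 Tf1] := Tsurj f.
have Tpi g : T (pi g f1) = pi g f.
  rewrite -Tf1; apply/esym/Tcomm; first exact: (unitary_continuous (piU g)).
  by move=> x; exact: (frame_operator_commute mu_mult pi_rep _ _ b0 bessel).
have P : parseval_sum (fun g => pi g f1).
  move=> y; have [x <-] := Tsurj y.
  have [_ _ TT] := Tsqrt.
  rewrite -hdot_norm Tadj TT -(frame_operator_adj b0 bessel).
  rewrite (frame_operator_dot b0 bessel).
  apply: eq_has_sum (l2dot_normP (frame_coef_sqsum bessel x)) => g.
  by rewrite /frame_coef Tadj Tpi.
exists f1; split; first exact: parseval_sum_frame.
  by exists T.
exists (dilation_space pi f1), (fun g => dilation_act pi_rep P g),
  (dilation_vector P); split.
- exact: dilation_rep.
- exact/parseval_sum_frame/dilation_parseval.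
- apply: parseval_orthonormal_basis; first exact: dilation_orthonormal.
  exact: dilation_hsum_parseval.
Qed.
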